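(* With the setting and notation of the context, $\widetilde P=\int\widetilde\pi(dw)\,\widetilde P_w$ is the only probability $Q$ on $C(\mathbb{R}_+,\mathring{C})$ such that $Q$ is stationary and, for every smooth compactly supported function $\psi$ on $\mathring{C}$, under $Q$ the process $$\psi(W_t)-\int_0^t\widetilde A\psi(W_s)\,ds,\quad t\ge0,$$ is an $(\mathcal{F}_t)_{t\ge0}$-martingale.
   Context: Setting: $n\ge4$ is an integer, $N=2n$, and $1=\lambda_1=\lambda_2<\lambda_3=\lambda_4<\dots<\lambda_{N-1}=\lambda_N$ are reals; $\mu_i=\lambda_{2i}=\lambda_{2i-1}$, $1\le i\le n$. $a>0$ is a real number and $\delta_\ell\in(-1,0]$, $1\le\ell\le N$, satisfy $\delta_{2i}=\delta_{2i-1}$ for $1\le i\le n$. $C=\{(u,v)\in\mathbb{R}^2;\ 0\le v\le u\le\lambda_Nv\}$, with interior $\mathring{C}$. Sums over $\ell$ run over $1\le\ell\le N$. Functions $q_\ell$: for $(u,v)\in\mathring{C}$ consider the compact convex polytope $\mathbb{V}_{u,v}=\{(s_3,\dots,s_n)\in[0,\infty)^{n-2};\ \sum_{i=3}^n(1-\frac{\mu_1}{\mu_i})s_i\le u-\mu_1v,\ \sum_{i=3}^n(1-\frac{\mu_2}{\mu_i})s_i\ge u-\mu_2v\}$, which has positive Lebesgue measure. For $3\le i\le n$, $\widehat q_i(u,v)$ is the mean of $s_i$ under the normalized Lebesgue measure on $\mathbb{V}_{u,v}$; $\widehat q_1(u,v),\widehat q_2(u,v)$ are then determined by $\sum_{i=1}^n\widehat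 q_i(u,v)=u$, $\sum_{i=1}^n\frac1{\mu_i}\widehat q_i(u,v)=v$. Set $q_{2i}=q_{2i-1}=\frac12\widehat q_i$, $1\le i\le n$. Operator: for smooth $\psi$ on $\mathring{C}$, $$\widetilde A\psi=2a\Big\{\sum_\ell\lambda_\ell(1+\delta_\ell)q_\ell\,\partial_u^2\psi+2\sum_\ell(1+\delta_\ell)q_\ell\,\partial^2_{u,v}\psi+\sum_\ell\tfrac1{\lambda_\ell}(1+\delta_\ell)q_\ell\,\partial_v^2\psi\Big\}+\Big(a\sum_\ell\lambda_\ell(1+\delta_\ell)-2\sum_\ell\lambda_\ell q_\ell\Big)\partial_u\psi+\Big(a\sum_\ell(1+\delta_\ell)-2\sum_\ell q_\ell\Big)\partial_v\psi.$$ Diffusion: on the space $C(\mathbb{R}_+,\mathring{C})$ of continuous $\mathring{C}$-valued paths, with canonical process $(W_t)_{t\ge0}$ and canonical filtration $(\mathcal{F}_t)_{t\ge0}$, for $w\in\mathring{C}$, $\widetilde P_w$ denotes the unique probability (existence and uniqueness hold) such that $\widetilde P_w(W_0=w)=1$ and $\psi(W_t)-\int_0^t\widetilde A\psi(W_s)\,ds$, $t\ge0$, is an $(\mathcal{F}_t)$-martingale for every smooth compactly supported $\psi$ on $\mathring{C}$. The family $(\widetilde P_w)$ is a strong Markov process, and $\widetilde\pi$ denotes its unique stationary probability on $\mathring{C}$ (existence and uniqueness hold), i.e. the unique probability with $\int\widetilde\pi(dw)\widetilde P_w[W_t\in\cdot\,]=\widetilde\pi$ for all $t\ge0$. A probability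 $Q$ on $C(\mathbb{R}_+,\mathring{C})$ is stationary if for each $s\ge0$ the law of $(W_{t+s})_{t\ge0}$ under $Q$ equals $Q$. *)

(* Defs.v *)
From HB Require Import structures.
From mathcomp Require Import all_boot all_order all_algebra.
From mathcomp Require Import all_classical all_reals all_analysis.
From mathcomp Require Import ring lra zify.

Set Implicit Arguments.
Unset Strict Implicit.
Unset Printing Implicit Defensive.

Import Order.TTheory GRing.Theory Num.Theory.
Import numFieldNormedType.Exports.

Local Open Scope classical_set_scope.
Local Open Scope ring_scope.

(* Lebesgue measure on R^m, seen as m.-tuple R: the m-fold product measure,
   transported along the bijections (x, s) |-> x :: s from R * R^m to R^(m+1). *)
Section lebesgue_tuple.
Context {R : realType}.
Local Notation RT := (measurableTypeR R).

Definition cons_pair m (p : RT * m.-tuple RT) : m.+1.-tuple RT :=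
  [the m.+1.-tuple RT of p.1 :: p.2].

Lemma measurable_cons_pair m : measurable_fun setT (@cons_pair m).
Proof. exact: measurable_cons. Qed.

Section step.
Context (m : nat) (nu : {sigma_finite_measure set (m.-tuple RT) -> \bar R}).

Definition lebesgue_cons : set (m.+1.-tuple RT) -> \bar R :=
  pushforward (@lebesgue_measure R \x nu)%E (@cons_pair m).

Let lebesgue_cons0 : lebesgue_cons set0 = 0%E.
Proof. by rewrite /lebesgue_cons/= /pushforward preimage_set0 measure0. Qed.

Let lebesgue_cons_ge0 A : (0 <= lebesgue_cons A)%E.
Proof. by rewrite /lebesgue_cons /pushforward. Qed.

Let lebesgue_cons_sigma_additive : semi_sigma_additive lebesgue_cons.
Proof.
pose mu : {measure set (m.+1.-tuple RT) -> \bar R} :=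
  measure_function_pushforward__canonical__measure_function_Measure
    (@lebesgue_measure R \x nu)%E (@measurable_cons_pair m).
exact: (@measure_semi_sigma_additive _ _ _ mu).
Qed.

HB.instance Definition _ := isMeasure.Build _ _ _ lebesgue_cons
  lebesgue_cons0 lebesgue_cons_ge0 lebesgue_cons_sigma_additive.

Let lebesgue_cons_sigma_finite : sigma_finite setT lebesgue_cons.
Proof.
have /sigma_finiteP[F [TF ndF Foo]] := sigma_finiteT (@lebesgue_measure R).
have /sigma_finiteP[G [TG ndG Goo]] := sigma_finiteT nu.
pose g (s : m.+1.-tuple RT) := (thead s, [tuple of behead s]).
have mg : measurable_fun setT g.
  by apply: measurable_fun_pair; [exact: measurable_tnth|exact: measurable_behead].
have gK : cancel (@cons_pair m) g.
  by move=> [x s]; rewrite /g /cons_pair/=; congr pair; apply/val_inj.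
exists (fun k => g @^-1` (F k `*` G k)).
  apply/seteqP; split=> // s _.
  have [i _ Fi] : (\bigcup_k F k) (thead s) by rewrite -TF.
  have [j _ Gj] : (\bigcup_k G k) [tuple of behead s] by rewrite -TG.
  exists (maxn i j) => //; split => /=.
    by move: Fi; apply/subsetPset/ndF/leq_maxl.
  by move: Gj; apply/subsetPset/ndG/leq_maxr.
move=> k; have [mF Fk] := Foo k; have [mG Gk] := Goo k; split.
  by rewrite -[X in measurable X]setTI; apply: mg => //; exact: measurableX.
rewrite /lebesgue_cons /pushforward.
rewrite (_ : _ @^-1` _ = F k `*` G k); last first.
  by apply/funext => p; rewrite -[in RHS](gK p).
by rewrite product_measure1E// lte_mul_pinfty// ge0_fin_numE.
Qed.

HB.instance Definition _ := Measure_isSigmaFinite.Build _ _ _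
  lebesgue_cons lebesgue_cons_sigma_finite.
End step.

Fixpoint lebesgue_tuple m : {sigma_finite_measure set (m.-tuple RT) -> \bar R} :=
  if m is k.+1 then lebesgue_cons (lebesgue_tuple k) else \d_[tuple].

End lebesgue_tuple.

(* Indices are 1-based as in lam_1, ..., lam_N and mu_1, ..., mu_n (N = 2n);
   values of lam, delta outside 1, ..., N are never used. *)
Record spectrum (R : realType) (n : nat) (lam : nat -> R) : Prop := Spectrum {
  spectrum_n_ge4 : (4 <= n)%N ;
  spectrum1 : lam 1%N = 1 ;
  spectrum_pair : forall i, (1 <= i <= n)%N -> lam (2 * i - 1)%N = lam (2 * i)%N ;
  spectrum_lt : forall i, (1 <= i < n)%N -> lam (2 * i)%N < lam (2 * i + 1)%N
}.

Section operator.
Context {R : realType}.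
Context (n : nat) (lam : nat -> R).
Local Notation RT := (measurableTypeR R).

Definition mu (i : nat) : R := lam (2 * i)%N.

Definition cone : set (R * R) :=
  [set w | [/\ 0 <= w.2, w.2 <= w.1 & w.1 <= lam (2 * n)%N * w.2]].

(* The point (s_3, ..., s_n) of R^(n-2). *)
Definition entry (s : (n - 2).-tuple RT) (i : nat) : R := nth 0 s (i - 3).

Definition polytope (w : R * R) : set ((n - 2).-tuple RT) :=
  [set s | [/\ forall i, (3 <= i <= n)%N -> 0 <= entry s i,
      \sum_(3 <= i < n.+1) (1 - mu 1 / mu i) * entry s i <= w.1 - mu 1 * w.2 &
      \sum_(3 <= i < n.+1) (1 - mu 2 / mu i) * entry s i >= w.1 - mu 2 * w.2]].

Definition polytope_mean (i : nat) (w : R * R) : R :=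
  (\int[lebesgue_tuple (n - 2)]_(s in polytope w) entry s i) /
  fine (lebesgue_tuple (n - 2) (polytope w)).

(* qhat 1 and qhat 2 are the solution of the 2 x 2 linear system
   x + y = u - \sum_(3 <= i) qhat_i,
   x / mu_1 + y / mu_2 = v - \sum_(3 <= i) qhat_i / mu_i;
   see sum_qhat and sum_qhat_div. *)
Definition qhat (i : nat) (w : R * R) : R :=
  let A := w.1 - \sum_(3 <= j < n.+1) polytope_mean j w in
  let B := w.2 - \sum_(3 <= j < n.+1) (mu j)^-1 * polytope_mean j w in
  let D := (mu 1)^-1 - (mu 2)^-1 in
  if i == 1%N then (B - (mu 2)^-1 * A) / D
  else if i == 2%N then ((mu 1)^-1 * A - B) / D
  else polytope_mean i w.

(* uphalf (2 * i) = uphalf (2 * i - 1) = i. *)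
Definition qfun (l : nat) (w : R * R) : R := qhat (uphalf l) w / 2.

Context (hlam : spectrum n lam).

Lemma mu_gt0 i : (1 <= i <= n)%N -> 0 < mu i.
Proof.
case: hlam => n4 lam1 lamP lamL.
elim: i => [//|[_ _|i IHi /andP[_ ltin]]].
  by rewrite /mu -lamP ?muln1 ?lam1// (leq_trans _ n4).
have le1n : (1 <= i.+1 <= n)%N by rewrite /= ltnW.
apply: (lt_trans (IHi le1n)); rewrite /mu.
rewrite -(lamP i.+2) ?ltin// (_ : 2 * i.+2 - 1 = 2 * i.+1 + 1)%N; last first.
  by rewrite !mulnS; lia.
by apply: lamL.
Qed.

Lemma mu_lt i : (1 <= i < n)%N -> mu i < mu i.+1.
Proof.
case: hlam => n4 lam1 lamP lamL /andP[i1 ltin]; rewrite /mu.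
rewrite -(lamP i.+1) ?ltin// (_ : 2 * i.+1 - 1 = 2 * i + 1)%N; last first.
  by rewrite !mulnS; lia.
by apply: lamL; rewrite i1.
Qed.

Lemma mu1 : mu 1 = 1.
Proof.
case: hlam => n4 lam1 lamP _.
by rewrite /mu -lamP ?muln1 ?lam1// (leq_trans _ n4).
Qed.

Lemma lamN_gt1 : 1 < lam (2 * n)%N.
Proof.
have n4 := spectrum_n_ge4 hlam.
suff H k : (2 <= k <= n)%N -> 1 < mu k.
  by apply: (H n); rewrite leqnn andbT (leq_trans _ n4).
elim: k => [//|[//|[_ _|k IHk /andP[_ ltkn]]]].
  by rewrite -mu1; apply: mu_lt; rewrite (leq_trans _ n4).
have le2n : (2 <= k.+2 <= n)%N by rewrite /= ltnW.
by apply: (lt_trans (IHk le2n)); apply: mu_lt.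
Qed.

Let n_split (F : nat -> R) :
  \sum_(1 <= i < n.+1) F i = F 1%N + (F 2%N + \sum_(3 <= i < n.+1) F i).
Proof.
have n4 := spectrum_n_ge4 hlam.
rewrite (@big_ltn _ _ _ 1%N) ?(@big_ltn _ _ _ 2%N)//; lia.
Qed.

Let qhat_tail (F : nat -> R -> R) w :
  \sum_(3 <= i < n.+1) F i (qhat i w) =
  \sum_(3 <= i < n.+1) F i (polytope_mean i w).
Proof.
by apply: eq_big_nat => -[|[|[|i]]].
Qed.

Let mu12 : (mu 1)^-1 - (mu 2)^-1 != 0.
Proof.
have n4 := spectrum_n_ge4 hlam.
rewrite subr_eq0; apply/eqP => /invr_inj e.
by have := @mu_lt 1; rewrite e ltxx (leq_trans _ n4)// => /(_ isT).
Qed.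

Lemma sum_qhat w : \sum_(1 <= i < n.+1) qhat i w = w.1.
Proof.
rewrite n_split (qhat_tail (fun=> id)) /qhat/=.
move: mu12; move: (mu 1)^-1 (mu 2)^-1 => x y xy; field; exact: xy.
Qed.

Lemma sum_qhat_div w : \sum_(1 <= i < n.+1) (mu i)^-1 * qhat i w = w.2.
Proof.
rewrite n_split (qhat_tail (fun i x => (mu i)^-1 * x)) /qhat/=.
move: mu12; move: (mu 1)^-1 (mu 2)^-1 => x y xy; field; exact: xy.
Qed.

Definition eu : (R * R)%type := (1, 0).
Definition ev : (R * R)%type := (0, 1).

Definition generator (a : R) (delta : nat -> R) (psi : R * R -> R) (w : R * R) : R :=
  2 * a *
    ((\sum_(1 <= l < (2 * n).+1) lam l * (1 + delta l) * qfun l w) * 'D_eu ('D_eu psi) w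
     + 2 * (\sum_(1 <= l < (2 * n).+1) (1 + delta l) * qfun l w) * 'D_eu ('D_ev psi) w
     + (\sum_(1 <= l < (2 * n).+1) (lam l)^-1 * (1 + delta l) * qfun l w) * 'D_ev ('D_ev psi) w)
  + (a * (\sum_(1 <= l < (2 * n).+1) lam l * (1 + delta l)) - 2 * (\sum_(1 <= l < (2 * n).+1) lam l * qfun l w)) * 'D_eu psi w
  + (a * (\sum_(1 <= l < (2 * n).+1) (1 + delta l)) - 2 * (\sum_(1 <= l < (2 * n).+1) qfun l w)) * 'D_ev psi w.

(* Iterated partial derivatives: true stands for d/du, false for d/dv. *)
Fixpoint partial (s : seq bool) (psi : R * R -> R) : R * R -> R :=
  if s is b :: s' then 'D_(if b then eu else ev) (partial s' psi) else psi.

Definition smooth (psi : R * R -> R) : Prop :=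
  forall s, continuous (partial s psi) /\
    forall w, derivable (partial s psi) w eu /\ derivable (partial s psi) w ev.

(* Smooth compactly supported functions on the interior of the cone, extended
   by zero to the plane. *)
Definition test_function (psi : R * R -> R) : Prop :=
  let supp := closure [set w | psi w != 0] in
  [/\ smooth psi, compact supp & supp `<=` cone°].

End operator.

Definition time (R : realType) : Type := `[0, +oo[%classic : set R.

HB.instance Definition _ (R : realType) := Topological.on (time R).

Lemma time_subproof (R : realType) (x : R) :
  Num.max 0 x \in (`[0, +oo[%classic : set R).
Proof. by rewrite inE/= in_itv/= andbT le_max lexx. Qed.

(* totime x is x when 0 <= x; negative reals are sent to 0. *)
Definition totime (R : realType) (x : R) : time R :=
  exist _ (Num.max 0 x) (time_subproof x).

Definition time_val (R : realType) (t : time R) : R := \val t.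

(* The open cone as a space of its own, with the subspace topology and the
   trace of the Borel sigma-algebra of the plane. *)
Section open_cone.
Context {R : realType} {n : nat} {lam : nat -> R}.

Definition open_cone of spectrum n lam : Type := (cone n lam)° : set (R * R).

Context (hlam : spectrum n lam).

HB.instance Definition _ := Topological.on (open_cone hlam).

Definition cone_val (w : open_cone hlam) : R * R := \val w.

Let lamN := lam (2 * n)%N.

Lemma cone_point_subproof :
  ((1 + lamN) / 2, 1) \in ((cone n lam)° : set (R * R)).
Proof.
have lam1 : 1 < lamN := lamN_gt1 hlam.
have oP (f : R * R -> R) : continuous f -> open [set w | 0 < f w].
  by move=> cf; apply: (open_comp (D := [set x : R | 0 < x])) => [w _|];
    [exact: cf|exact: open_gt].
pose U := [set w : R * R | 0 < w.2] `&` [set w | 0 < w.1 - w.2] `&`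
  [set w | 0 < lamN * w.2 - w.1].
have oU : open U.
  apply: openI; first apply: openI; apply: oP => w.
  - exact: cvg_snd.
  - by apply: cvgB; [exact: cvg_fst|exact: cvg_snd].
  - by apply: cvgB; [apply: cvgMr; exact: cvg_snd|exact: cvg_fst].
have UC : U `<=` (cone n lam)°.
  rewrite -open_subsetE// => w [[/= w2 w12] w1].
  by rewrite /cone/= -/lamN; split; lra.
rewrite inE; apply: UC.
split; [split|] => /=; lra.
Qed.

Definition cone_point : open_cone hlam :=
  exist (fun w => w \in ((cone n lam)° : set (R * R))) _ cone_point_subproof.

HB.instance Definition _ := isPointed.Build (open_cone hlam) cone_point.

HB.instance Definition _ := Measurable.copy (open_cone hlam)
  (g_sigma_algebra_preimageType cone_val).

Definition path_space : Type := continuousType (time R) (open_cone hlam).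

HB.instance Definition _ := Choice.on path_space.

HB.instance Definition _ := isPointed.Build path_space (cst point).

(* The sigma-algebra generated by W_s, s <= t, and the one generated by all W_s. *)
Definition canonical_filtration (t : time R) : set (set path_space) :=
  <<s [set A | exists s, time_val s <= time_val t /\
        exists2 B : set (open_cone hlam), measurable B & A = [set W : path_space | B (W s)]] >>.

Definition path_generators : set (set path_space) :=
  [set A | exists s : time R,
        exists2 B : set (open_cone hlam), measurable B & A = [set W : path_space | B (W s)]].

HB.instance Definition _ := Measurable.copy path_space
  (g_sigma_algebraType path_generators).

Lemma continuous_shift (s : time R) (W : path_space) :
  continuous (fun t : time R => W (totime (time_val s + time_val t))).
Proof.
have ct : continuous (@totime R).
  apply: (continuous_comp_initial (w := set_val)) => x.
  by apply: (@continuous_max _ _ (cst 0) id); [exact: cvg_cst|exact: cvg_id].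
have cv : continuous (@time_val R) by exact: initial_continuous.
move=> t; apply: (@continuous_comp _ _ _
  (fun t : time R => totime (time_val s + time_val t)) W); last exact: cts_fun.
apply: (@continuous_comp _ _ _ (fun t => time_val s + time_val t)
  (@totime R)); last exact: ct.
apply: (@continuous_comp _ _ _ (@time_val R) (fun x => time_val s + x)).
  exact: cv.
by apply: cvgD; [exact: cvg_cst|exact: cvg_id].
Qed.

(* theta_s W = (W_(s + t))_(t >= 0). *)
Definition shift_path (s : time R) (W : path_space) : path_space :=
  [the continuousType _ _ of mkcts (@continuous_shift s W)].

End open_cone.

(* The probability \int pi(dw) P_w. *)
Section mixture.
Context d d' (T : measurableType d) (U : measurableType d') (R : realType).
Context (pi : probability T R) (P : R.-pker T ~> U).
Local Open Scope ereal_scope.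

Definition mixture (A : set U) : \bar R := \int[pi]_w P w A.

Let mixture0 : mixture set0 = 0.
Proof. by apply: integral0_eq => w _; rewrite measure0. Qed.

Let mixture_ge0 A : 0 <= mixture A.
Proof. by apply: integral_ge0 => w _; exact: measure_ge0. Qed.

Let mixture_sigma_additive : semi_sigma_additive mixture.
Proof.
move=> F mF tF mUF.
rewrite /mixture (eq_integral (fun w => \sum_(0 <= i <oo) P w (F i))).
  rewrite integral_nneseries//.
  - by apply: is_cvg_ereal_nneg_natsum => i _; exact: mixture_ge0.
  - by move=> i; exact: measurable_kernel.
move=> w _; apply/esym/cvg_lim => //.
exact: measure_semi_sigma_additive.
Qed.

HB.instance Definition _ := isMeasure.Build _ _ _ mixture
  mixture0 mixture_ge0 mixture_sigma_additive.

Let mixture_setT : mixture setT = 1.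
Proof.
rewrite /mixture (eq_integral (fun=> 1)); last by move=> w _; exact: prob_kernel.
by rewrite integral_cst// mul1e; exact: probability_setT.
Qed.

HB.instance Definition _ := Measure_isProbability.Build _ _ _ mixture mixture_setT.

End mixture.

Definition martingale d (T : measurableType d) (R : realType)
    (Q : {measure set T -> \bar R}) (F : time R -> set (set T)) (X : time R -> T -> R) :=
  [/\ forall t (B : set R), measurable B -> F t (X t @^-1` B),
      forall t, Q.-integrable setT (EFin \o X t) &
      forall s t, time_val s <= time_val t -> forall A, F s A ->
        (\int[Q]_(x in A) (X t x)%:E = \int[Q]_(x in A) (X s x)%:E)%E].

Section diffusion.
Context {R : realType} {n : nat} {lam : nat -> R} {hlam : spectrum n lam}.
Local Notation open_cone := (open_cone hlam).
Local Notation path_space := (path_space hlam).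
Implicit Types (Q : {measure set path_space -> \bar R}) (P : R.-pker open_cone ~> path_space).

Definition martingale_process (a : R) (delta : nat -> R) (psi : R * R -> R)
    (t : time R) (W : path_space) : R :=
  psi (cone_val (W t)) - \int[lebesgue_measure]_(s in `[0, time_val t])
    generator n lam a delta psi (cone_val (W (totime s))).

Definition martingale_problem (a : R) (delta : nat -> R) Q : Prop :=
  forall psi, test_function n lam psi ->
    martingale Q (@canonical_filtration R n lam hlam)
      (martingale_process a delta psi).

(* Measures are total functions on sets, meaningful on measurable sets only, so
   that equality of laws is always tested on measurable sets. *)
Definition starts_at (w : open_cone) Q : Prop :=
  Q [set W : path_space | W (totime 0) = w] = 1%E.

Definition stationary Q : Prop :=
  forall s (A : set path_space), measurable A -> Q (shift_path s @^-1` A) = Q A.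

Definition stationary_distribution P (pi : probability open_cone R) : Prop :=
  forall t (B : set open_cone), measurable B ->
    (\int[pi]_w P w [set W : path_space | B (W t)])%E = pi B.

Definition stopping_time (tau : path_space -> \bar R) : Prop :=
  (forall W, 0 <= tau W)%E /\
  forall t, canonical_filtration t [set W | (tau W <= (time_val t)%:E)%E].

(* The sigma-algebra F_tau. *)
Definition stopped_sigma (tau : path_space -> \bar R) : set (set path_space) :=
  [set A | measurable A /\ forall t,
    canonical_filtration t (A `&` [set W | (tau W <= (time_val t)%:E)%E])].

(* P_w[A, tau < oo, theta_tau W \in B] = E_w[P_(W_tau)[B]; A, tau < oo]. *)
Definition strong_markov P : Prop :=
  forall tau, stopping_time tau ->
  forall w (A B : set path_space), stopped_sigma tau A -> measurable B ->
    let T W := totime (fine (tau W)) in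
    let A' := A `&` [set W | (tau W < +oo)%E] in
    (P w (A' `&` [set W | B (shift_path (T W) W)]) =
     \int[P w]_(W in A') P (W (T W)) B)%E.

End diffusion.

(* Main.v *)
From HB Require Import structures.
Require Import Defs.
From mathcomp Require Import all_boot all_order all_algebra.
From mathcomp Require Import all_classical all_reals all_analysis.
From mathcomp Require Import measurable_realfun.
From mathcomp Require Import ring lra zify.

Set Implicit Arguments.
Unset Strict Implicit.
Unset Printing Implicit Defensive.

Import Order.TTheory GRing.Theory Num.Theory.
Import numFieldNormedType.Exports.

Local Open Scope classical_set_scope.
Local Open Scope ring_scope.

(* That [mixture pi P] solves the stationary martingale problem follows by
   integrating the martingale identities of the [P w] (the martingales are
   bounded on bounded time intervals) and from the Markov property at a fixed
   time.

   For uniqueness, let [Q] be a stationary solution, with law [nu] at time 0.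
   Disintegrate [Q] with respect to the starting point. The path space is a
   measurable retract of the real line (paths are determined by countably many
   bits, and the images of continuous paths form a measurable set), so it is
   enough to condition a real random variable, by means of its conditional
   quantile function. Test functions are separable for the norm of the uniform
   convergence of the derivatives of order at most 2, and the filtration is
   generated, at rational times, by countable pi-systems, so that countably many
   identities express the martingale problem. Each of them holds for [nu]-almost
   all conditional laws, which therefore solve the martingale problem started at
   a point and are equal to [P w]. Hence [Q] is the mixture of the [P w] under
   [nu], stationarity of [Q] makes [nu] a stationary distribution, and [nu = pi]. *)

(** * Conditional quantiles *)

(** Uniqueness is assumed for laws started at a point, whereas [Q] starts from an unknown law; only
    its conditional laws can be compared with the [P w]. They are all realized as images of one
    uniform law under a single map [G (w, u)], so that a statement holding for almost every starting
    point becomes an application of Fubini's theorem to a product measure.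

    Of the coefficients [qfun l], the estimates use measurability and boundedness on bounded parts
    of the cone. This makes the martingale processes bounded on bounded time intervals and stable
    under perturbation of the test function, with constants that depend on the test function through
    a bound of its support. Hence the countable family of test functions has to approximate a given
    one while keeping the same support bound. *)

Lemma ae_forall_countable d (T : measurableType d) (R : realType)
  (mu : {measure set T -> \bar R}) (I : countType) (P : I -> T -> Prop) :
  (forall i, {ae mu, forall x, P i x}) -> {ae mu, forall x, forall i, P i x}.
Proof.
move=> PP.
have : {ae mu, forall x, forall k : nat, forall i, unpickle k = Some i -> P i x}.
  apply/ae_foralln => k; case: (unpickle k) => [i|]; last by apply/aeW.
  by apply: filterS (PP i) => x Px _ [<-].
by apply: filterS => x + i => /(_ (pickle i) i); apply; rewrite pickleK.
Qed.

Lemma measurable_preimageT d d' (T : measurableType d) (U : measurableType d')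
  (f : T -> U) (B : set U) :
  measurable_fun setT f -> measurable B -> measurable (f @^-1` B).
Proof. by move=> mf mB; rewrite -[X in measurable X]setTI; exact: mf. Qed.

Lemma measurable_set_ltr d (T : measurableType d) (R : realType) (f g : T -> R) :
  measurable_fun setT f -> measurable_fun setT g ->
  measurable [set x | f x < g x].
Proof.
move=> mf mg; have := measurable_fun_ltr mf mg measurableT (Y := [set true]).
by rewrite setTI; apply.
Qed.

Lemma measurable_set_ler d (T : measurableType d) (R : realType) (f g : T -> R) :
  measurable_fun setT f -> measurable_fun setT g ->
  measurable [set x | f x <= g x].
Proof.
move=> mf mg; have := measurable_fun_ler mf mg measurableT (Y := [set true]).
by rewrite setTI; apply.
Qed.

Section conditional_cdf.
Context d (T : measurableType d) (R : realType).
Implicit Types mu : {measure set T -> \bar R}.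

(** Apply the hypothesis to the set where [g < f]: there [f - g] is positive with integral at most
    0, so the set is negligible. *)
Lemma ae_le_integral mu (f g : T -> R) :
  mu.-integrable setT (EFin \o f) -> mu.-integrable setT (EFin \o g) ->
  (forall B, measurable B ->
    (\int[mu]_(x in B) (f x)%:E <= \int[mu]_(x in B) (g x)%:E)%E) ->
  {ae mu, forall x, f x <= g x}.
Proof.
move=> fi gi fg.
have mf : measurable_fun setT f by apply/measurable_EFinP; exact: measurable_int fi.
have mg : measurable_fun setT g by apply/measurable_EFinP; exact: measurable_int gi.
pose D := [set x | g x < f x].
have mD : measurable D by exact: measurable_set_ltr.
have fiD := integrableS measurableT mD (@subsetT _ D) fi.
have giD := integrableS measurableT mD (@subsetT _ D) gi.
have : (\int[mu]_(x in D) `|(f x)%:E - (g x)%:E| = 0)%E.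
  rewrite (eq_integral (fun x => (f x)%:E - (g x)%:E)%E); last first.
    move=> x; rewrite inE /D/= => /ltW gf.
    by rewrite ger0_norm ?subr_ge0.
  apply/eqP; rewrite eq_le; apply/andP; split.
    rewrite integralB// sube_le0 ?fg//.
  apply: integral_ge0 => x /ltW gf; rewrite sube_ge0// lee_fin//.
move/(ae_eq_integral_abs mu mD).
have mh : measurable_fun D (fun x => (f x)%:E - (g x)%:E)%E.
  exact: measurable_int (integrableB mD fiD giD).
move=> /(_ mh); apply: filterS => x /= h.
rewrite leNgt; apply/negP => gf; have := h gf.
by rewrite -EFinD => -[/eqP]; rewrite subr_eq0 gt_eqF.
Qed.

End conditional_cdf.

Section transfer.
Context d d' (E : measurableType d) (T : measurableType d') (R : realType).
Context (Q : probability T R) (W0 : {mfun T >-> E}) (phi : {mfun T >-> R}).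
Local Notation nu := (distribution Q W0).

(** The function is the conditional probability of [D] given [W0]: the image under [W0] of [Q]
    restricted to [D] is dominated by [nu], and [f] is its Radon-Nikodym derivative. *)
Lemma measure_slice_exists (D : set T) : measurable D ->
  exists f : E -> R, nu.-integrable setT (EFin \o f) /\
    forall B, measurable B ->
      (\int[nu]_(x in B) (f x)%:E = Q (D `&` W0 @^-1` B))%E.
Proof.
move=> mD.
have Doo : (Q D < +oo)%E by rewrite (le_lt_trans (probability_le1 _ _))// ltry.
pose m := pushforward (mfrestr mD Doo) W0.
have mm : measurable_fun setT W0 by exact: measurable_funPT.
pose m' : {measure set E -> \bar R} :=
  measure_function_pushforward__canonical__measure_function_Measure
    (mfrestr mD Doo) mm.
have mle A : measurable A -> (m' A <= nu A)%E.
  move=> mA; rewrite /m'/= /pushforward/= /mfrestr/= /mrestr.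
  have mWA : measurable (W0 @^-1` A) by exact: measurable_preimageT.
  by apply: le_measure; rewrite ?inE//; exact: measurableI.
have moo : (m' setT < +oo)%E.
  by rewrite (le_lt_trans (mle _ _))// (le_lt_trans (probability_le1 _ _))// ltry.
pose mf : {finite_measure set E -> \bar R} := mfrestr measurableT moo.
have mfE A : mf A = m' A by rewrite /mf/= /mfrestr/= /mrestr setIT.
have dom : mf `<< nu.
  apply/null_content_dominatesP => A mA nA.
  have nuA : nu A = 0%E by exact: nA.
  by apply/eqP; rewrite eq_le measure_ge0 andbT mfE -nuA mle.
have [f [f0 ffin fi fE]] := radon_nikodym_sigma_finite dom.
exists (fine \o f); split.
  apply: eq_integrable fi => // x _ /=; by rewrite fineK.
move=> B mB; rewrite setIC.
transitivity (mf B); last exact: mfE.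
rewrite (fE _ mB).
by apply: eq_integral => x _; rewrite /= fineK.
Qed.

Lemma conditional_cdf_exists : exists f : rat -> E -> R,
  [/\ forall q, measurable_fun setT (f q),
      forall q w, 0 <= f q w <= 1,
      forall p q w, p <= q -> f p w <= f q w &
      forall q B, measurable B ->
      (\int[nu]_(x in B) (f q x)%:E =
       Q (phi @^-1` `]-oo, (ratr q : R)] `&` W0 @^-1` B))%E].
Proof.
have mphi q : measurable (phi @^-1` `]-oo, (ratr q : R)]).
  exact: measurable_preimageT.
have mWB B : measurable B -> measurable (W0 @^-1` B).
  exact: measurable_preimageT.
have [f /all_and2[fi fE]] := choice (fun q => measure_slice_exists (mphi q)).
have mf q : measurable_fun setT (f q).
  by apply/measurable_EFinP; exact: measurable_int (fi q).
have aele (p q : rat) : {ae nu, forall x, p <= q -> f p x <= f q x}.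
  have [pq|pq] := leP p q; last by apply/aeW.
  have : {ae nu, forall x, f p x <= f q x}.
    apply: ae_le_integral => // B mB; rewrite !fE//.
    apply: le_measure; rewrite ?inE; try by apply: measurableI => //; exact: mWB.
    apply: setSI => x /=; rewrite !in_itv/= => /le_trans; apply.
    by rewrite ler_rat.
  by apply: filterS.
have ae0 q : {ae nu, forall x, 0 <= f q x}.
  apply: ae_le_integral => //; first exact: integrable0.
  by move=> B mB; rewrite integral0 fE// measure_ge0.
have ae1 q : {ae nu, forall x, f q x <= 1}.
  apply: ae_le_integral => //.
    by apply: finite_measure_integrable_cst.
  move=> B mB; rewrite fE// integral_cst// mul1e /=.
  rewrite /distribution /pushforward.
  by apply: le_measure; rewrite ?inE//; [apply: measurableI|]; try exact: mWB.
pose good q x := [/\ 0 <= f q x, f q x <= 1 & forall p, p <= q -> f p x <= f q x].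
have aegood : {ae nu, forall x, forall q, good q x}.
  apply: ae_forall_countable => q.
  have : {ae nu, forall x, forall p, p <= q -> f p x <= f q x}.
    by apply: ae_forall_countable => p; exact: aele.
  apply: filterS3 (ae0 q) (ae1 q) => x ? ? ?; by split.
have [N [mN N0 Nbad]] := aegood.
(* The bounds and the monotonicity fail at most on the null set [N]. The constant 1 there restores
   them everywhere and changes no integral. *)
pose g q w := if w \in N then 1 else f q w.
have gN q w : w \notin N -> good q w.
  move=> wN; apply: contrapT => bad; move/negP: wN; apply; rewrite inE; apply: Nbad => /=.
  by move=> /(_ q).
have mg q : measurable_fun setT (g q).
  apply: measurable_fun_ifT => //.
  apply: (measurable_fun_bool true); rewrite setTI.
  by rewrite preimage_mem_true.
exists g; split=> //.
- move=> q w; rewrite /g; case: ifPn => [_|/gN-/(_ q)[-> ->]//].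
  by rewrite ler01 lexx.
- move=> p q w pq; rewrite /g; case: ifPn => // /gN-/(_ q)[_ _]; exact.
- move=> q B mB; rewrite -fE//; apply: ae_eq_integral => //.
  + by apply/measurable_EFinP; exact: measurable_funTS.
  + by apply/measurable_EFinP; exact: measurable_funTS.
  + exists N; split => // x /= h; apply: contrapT => xN; apply: h => _.
    by rewrite /g memNset.
Qed.

End transfer.

(** Continuity from below along [c' = c - 1/(k+1)]. The gap between [c'] and [c] leaves room for
    rationals, the only points where the distribution functions below are known. *)
Lemma ray_le (R : realType) (m1 m2 : {measure set R -> \bar R}) :
  (forall c' c, c' < c -> (m1 `]-oo, c'[%classic <= m2 `]-oo, c[%classic)%E) ->
  forall c, (m1 `]-oo, c[%classic <= m2 `]-oo, c[%classic)%E.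
Proof.
move=> m12 c; pose F (k : nat) := `]-oo, (c - k.+1%:R^-1)[%classic : set R.
have FE : \bigcup_k F k = `]-oo, c[%classic.
  apply/seteqP; split => x.
    move=> [k _]; rewrite /F/= !in_itv/= => /lt_trans; apply.
    by rewrite ltrBlDr ltrDl.
  rewrite /= in_itv/= => /ltr_add_invr[k xk]; exists k => //.
  by rewrite /F/= in_itv/= ltrBrDr.
rewrite -FE; have /cvg_lim <- // : m1 (F k) @[k --> \oo] --> m1 (\bigcup_k F k).
  apply: nondecreasing_cvg_mu.
  - by move=> k; exact: measurable_itv.
  - by apply: bigcupT_measurable => k; exact: measurable_itv.
  - move=> i j ij; apply/subsetPset; rewrite /F => x /=; rewrite !in_itv/= => /lt_le_trans; apply.
    by rewrite lerB// lef_pV2 ?posrE// ler_nat.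
apply: lime_le; last by apply: nearW => k; rewrite FE m12// ltrBlDr ltrDl.
apply: ereal_nondecreasing_is_cvgn => i j ij; apply: le_measure; rewrite ?inE.
- exact: measurable_itv.
- exact: measurable_itv.
- rewrite /F => x /=; rewrite !in_itv/= => /lt_le_trans; apply.
  by rewrite lerB// lef_pV2 ?posrE// ler_nat.
Qed.

Lemma measure_eq_rays (R : realType) (m1 m2 : {measure set R -> \bar R}) :
  (forall c, m1 `]-oo, c[%classic < +oo)%E ->
  (forall c, m1 `]-oo, c[%classic = m2 `]-oo, c[%classic) ->
  forall A, measurable A -> m1 A = m2 A.
Proof.
move=> moo m12; apply: (measure_unique (@RGenInftyO.G R) (fun k => `]-oo, k%:R[%classic)).
- exact: RGenInftyO.measurableE.
- move=> _ _ [a ->] [b ->]; exists (Num.min a b).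
  by apply/seteqP; split => x /=; rewrite !in_itv/= lt_min => /andP.
- by move=> k; eexists.
- apply/seteqP; split => // x _; exists (Num.truncn `|x|).+1 => //=.
  by rewrite in_itv/= (le_lt_trans (ler_norm x))// truncnS_gt.
- by move=> _ [c ->].
- by move=> k.
Qed.

Section uniform_transfer.
Context (R : realType).
Local Notation U01 := (uniform_prob (@ltr01 R)).

Lemma uniform01_le (y : R) : 0 <= y <= 1 -> U01 [set t | t <= y] = y%:E.
Proof.
move=> /andP[y0 y1]; rewrite /uniform_prob integral_uniform_pdf.
rewrite (_ : _ `&` _ = `[0, y]%classic); last first.
  apply/seteqP; split => t /=; rewrite !in_itv/=; first by case=> -> /andP[->].
  by move=> /andP[t0 ty]; rewrite t0 ty (le_trans ty).
rewrite (eq_integral (fun=> 1%E)); last first.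
  move=> t; rewrite inE/= in_itv/= => /andP[t0 ty].
  by rewrite /uniform_pdf t0 (le_trans ty y1) subr0 invr1.
by rewrite integral_cst//= mul1e lebesgue_measure_itv/= lte_fin; case: ltP => //;
  rewrite ?sube0// => ?; congr EFin; apply/eqP; rewrite eq_le y0.
Qed.

Context d d' (E : measurableType d) (T : measurableType d').
Context (Q : probability T R) (W0 : {mfun T >-> E}) (phi : {mfun T >-> R}).
Local Notation nu := (distribution Q W0).

(* [Z w] is the quantile function of the conditional distribution of [phi]
   given [W0 = w], evaluated at a uniform variable. *)
Lemma uniform_transfer : (forall x, 0 <= phi x <= 1) ->
  exists Z : E * R -> R, measurable_fun setT Z /\
    forall B A, measurable B -> measurable A ->
      (nu \x U01)%E (fst @^-1` B `&` Z @^-1` A) = Q (W0 @^-1` B `&` phi @^-1` A).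
Proof.
move=> phi01; have [f [mf f01 fle fE]] := conditional_cdf_exists Q W0 phi.
(* The infimum of [S (w, u)] is the quantile of level [u]. The value 1 makes the set nonempty and
   the truncation at 0 bounds it below, in accordance with [phi] taking values in [[0, 1]]. *)
pose S (x : E * R) := [set y : R | y = 1 \/
  exists q : rat, y = Num.max 0 (ratr q) /\ x.2 <= f q x.1].
pose Z x := inf (S x).
have S0 x y : S x y -> 0 <= y.
  by move=> [->|[q [-> _]]]; rewrite ?ler01// le_max lexx.
have Slb x : has_lbound (S x) by exists 0 => y; exact: S0.
have hS x : has_inf (S x) by split => //; exists 1; left.
have Zlt (c : R) x : Z x < c <-> exists2 y, S x y & y < c.
  split.
    by move=> /(inf_lt (hS x).1)[y Sy yc]; exists y.
  by move=> [y Sy]; apply: le_lt_trans; exact: ge_inf.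
have ZltE (c : R) : [set x | Z x < c] = (if 1 < c then setT else set0) `|`
    \bigcup_(q in [set q : rat | Num.max 0 (ratr q) < c]) [set x | x.2 <= f q x.1].
  apply/seteqP; split => x /=.
    move=> /Zlt[y [->|[q [-> xq]]]]; first by move=> ->; left.
    by move=> qc; right; exists q.
  move=> [|[q qc xq]]; last by apply/Zlt; exists (Num.max 0 (ratr q)) => //; right; exists q.
  by case: ifPn => // c1 _; apply/Zlt; exists 1 => //; left.
(* By [ZltE], measurability of [Z] reduces to that of these countably many sets, since an infimum is
   below [c] exactly when some element is. *)
have mfq q : measurable [set x : E * R | x.2 <= f q x.1].
  apply: measurable_set_ler => //.
  by apply: measurableT_comp => //; exact: measurable_fst.
have mZ : measurable_fun setT Z.
  apply: (measurability _ (RGenInftyO.measurableE R)) => //.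
  move=> _ [_ [c ->] <-]; rewrite setTI.
  rewrite [X in measurable X](_ : _ = [set x | Z x < c]); last first.
    by apply/seteqP; split => x /=; rewrite in_itv.
  rewrite ZltE; apply: measurableU; first by case: ifP.
  rewrite bigcup_mkcond; apply: countable_bigcupT_measurable => // q.
  by case: ifP.
exists Z; split => // B A mB mA.
have mfB : measurable (fst @^-1` B : set (E * R)) by exact: measurable_preimageT.
have mWB : measurable (W0 @^-1` B) by exact: measurable_preimageT.
pose m1 : {measure set R -> \bar R} :=
  measure_function_pushforward__canonical__measure_function_Measure
    (mrestr (nu \x U01)%E mfB) mZ.
have mphi : measurable_fun setT phi by exact: measurable_funPT.
pose m2 : {measure set R -> \bar R} :=
  measure_function_pushforward__canonical__measure_function_Measure
    (mrestr Q mWB) mphi.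
have prodE (C : set (E * R)) : measurable C ->
    (nu \x U01)%E (fst @^-1` B `&` C) = (\int[nu]_(w in B) U01 (xsection C w))%E.
  move=> mC; rewrite /product_measure1 [RHS]integral_mkcond.
  apply: eq_integral => w _; rewrite patchE; case: ifPn => wB.
    congr (U01 _); apply/seteqP; split => t; rewrite /xsection/= !inE/=; first by case.
    by move=> ?; split => //; exact: set_mem.
  have /= -> : xsection (fst @^-1` B `&` C) w = set0.
    apply/seteqP; split => // t.
    by rewrite /xsection/= inE/= => -[/mem_set]; rewrite (negbTE wB).
  exact: measure0.
have prodf q : (nu \x U01)%E (fst @^-1` B `&` [set x | x.2 <= f q x.1]) =
    m2 `]-oo, ratr q]%classic.
  rewrite prodE// /m2/= /pushforward/= /mrestr/= -fE//; apply: eq_integral => w _.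
  rewrite [X in U01 X](_ : _ = [set t | t <= f q w]) ?uniform01_le//.
  by apply/seteqP; split => t; rewrite /xsection/= inE.
have m1E c : m1 `]-oo, c[%classic = (nu \x U01)%E (fst @^-1` B `&` [set x | Z x < c]).
  by rewrite /m1/= /pushforward/= /mrestr/= setIC; congr (_ (_ `&` _)).
have mZlt c : measurable [set x | Z x < c] by exact: measurable_set_ltr.
(* The law [m1] of [Z] and the law [m2] of [phi] are compared at rational points with a slack, since
   [u <= f p w] gives [Z <= p] only and not [Z < p]. The slack disappears through [ray_le]. *)
have lower (p q : rat) : p < q ->
    (m2 `]-oo, ratr p]%classic <= m1 `]-oo, ratr q[%classic)%E.
  move=> pq; rewrite m1E; have [p0|p0] := ltP p 0.
    rewrite /m2/= /pushforward/= /mrestr/=.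
    rewrite [X in Q X](_ : _ = set0) ?measure0//; apply/seteqP; split => // x [/=].
    rewrite in_itv/= => xp _; have /andP[x0 _] := phi01 x.
    by have := le_trans x0 xp; rewrite ler0q leNgt p0.
  rewrite -prodf; apply: le_measure; rewrite ?inE; try by apply: measurableI => //; (exact: mfq || exact: mZlt).
  apply: setIS => x /= xp; apply/Zlt; exists (Num.max 0 (ratr p)); first by right; exists p.
  by rewrite max_r ?ltr_rat// ler0q.
have r1 : ratr (1 : rat) = 1 :> R by rewrite rmorph1.
have upper (q : rat) : (m1 `]-oo, ratr q[%classic <= m2 `]-oo, ratr q]%classic)%E.
  have [q1|q1] := ltP 1 q.
    rewrite m1E /m2/= /pushforward/= /mrestr/=.
    rewrite [X in (_ <= Q X)%E](_ : _ = W0 @^-1` B); last first.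
      apply/seteqP; split => x /=; first by case.
      move=> ?; split => //; rewrite in_itv/=; have /andP[_ /le_trans] := phi01 x.
      by apply; rewrite -[1]r1 ler_rat ltW.
    rewrite prodE//; apply: (@le_trans _ _ (\int[nu]_(w in B) 1)%E).
      apply: ge0_le_integral => //.
        apply: measurable_funTS; apply: measurable_fun_xsection; exact: mZlt.
      by move=> w _; apply: probability_le1; apply: measurable_xsection; exact: mZlt.
    by rewrite integral_cst// mul1e.
  rewrite m1E -prodf; apply: le_measure; rewrite ?inE; try by apply: measurableI => //; (exact: mfq || exact: mZlt).
  apply: setIS => x /= /Zlt[y [->|[r [-> xr]]]].
    by rewrite -[1]r1 ltr_rat ltNge q1.
  rewrite gt_max ltr_rat => /andP[_ /ltW rq].
  exact: le_trans (fle _ _ _ rq).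
have mono (m : {measure set R -> \bar R}) (i j : itv_bound R) : (i <= j)%O ->
    (m [set` Interval -oo%O i] <= m [set` Interval -oo%O j])%E.
  move=> ij; apply: le_measure; rewrite ?inE; try exact: measurable_itv.
  by apply: subitvPr.
have m12 c : m1 `]-oo, c[%classic = m2 `]-oo, c[%classic.
  apply/eqP; rewrite eq_le; apply/andP; split; apply: ray_le => {}c1 {}c2 c12.
    have [q] := rat_in_itvoo c12; rewrite in_itv/= => /andP[c1q qc2].
    apply: (le_trans (mono m1 (BLeft c1) (BLeft (ratr q)) (ltW c1q))).
    by apply: (le_trans (upper q)); exact: mono.
  have [q] := rat_in_itvoo c12; rewrite in_itv/= => /andP[c1q qc2].
  have [p] := rat_in_itvoo c1q; rewrite in_itv/= => /andP[c1p pq].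
  apply: (le_trans (mono m2 (BLeft c1) (BRight (ratr p)) (ltW c1p))).
  rewrite ltr_rat in pq.
  by apply: (le_trans (lower _ _ pq)); apply: mono; exact: ltW.
have := @measure_eq_rays R m1 m2 _ m12 A mA.
rewrite /m1 /m2/= /pushforward/= /mrestr/= setIC [in X in _ = X]setIC; apply.
move=> c.
apply: (@le_lt_trans _ _ ((nu \x U01)%E (setT `*` setT))).
  apply: le_measure; rewrite ?inE; last by rewrite setXTT.
    by apply: measurableI => //; exact: measurable_preimageT.
  exact: measurableX.
rewrite product_measure1E//.
by rewrite ![X in (X * _)%E]probability_setT [X in (_ * X)%E]probability_setT mule1 ltry.
Qed.

End uniform_transfer.

(** * Coding paths by real numbers *)

Section ternary_code.
Context (R : realType).
Implicit Types b : nat -> bool.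

(** Base 3 with digits 0 and 1: a tail is worth at most 1/2, so a first digit 0 gives a code at most
    1/6 and a first digit 1 a code at least 1/3. Comparing with 1/3 therefore reads the digit,
    without the double expansions of base 2. *)
Fixpoint ternary_partial (k : nat) b : R :=
  if k is k'.+1 then ((b 0%N)%:R + ternary_partial k' (b \o S)) / 3 else 0.

Definition ternary_code b : R := limn (ternary_partial ^~ b).

Lemma ternary_partial_bound k b : 0 <= ternary_partial k b <= 2^-1.
Proof.
elim: k b => [|k IH] b /=; first by rewrite lexx invr_ge0 ler0n.
by have /andP[] := IH (b \o S); case: (b 0%N) => /=; lra.
Qed.

Lemma ternary_partial_nd b : nondecreasing_seq (ternary_partial ^~ b).
Proof.
apply/nondecreasing_seqP => k; elim: k b => [|k IH] b.
  by have /andP[] := ternary_partial_bound 1 b.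
by rewrite [leLHS]/= [leRHS]/= ler_pM2r// lerD2l.
Qed.

Lemma ternary_code_cvg b : ternary_partial ^~ b @ \oo --> ternary_code b.
Proof.
have : cvgn (ternary_partial ^~ b).
  apply: nondecreasing_is_cvgn; first exact: ternary_partial_nd.
  by exists 2^-1 => _ [k _ <-]; have /andP[] := ternary_partial_bound k b.
by [].
Qed.

Lemma ternary_code_bound b : 0 <= ternary_code b <= 2^-1.
Proof.
have c := @ternary_code_cvg b; apply/andP; split.
  apply: limr_ge; first by apply/cvg_ex; eexists; exact: c.
  by apply: nearW => k; have /andP[] := ternary_partial_bound k b.
apply: limr_le; first by apply/cvg_ex; eexists; exact: c.
by apply: nearW => k; have /andP[] := ternary_partial_bound k b.
Qed.

Lemma ternary_codeS b : ternary_code b = ((b 0%N)%:R + ternary_code (b \o S)) / 3.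
Proof.
have c1 : ternary_partial n.+1 b @[n --> \oo] --> ternary_code b.
  by have := @ternary_code_cvg b; rewrite -(cvg_shiftS (ternary_partial ^~ b)).
apply: (cvg_unique (@Rhausdorff R) c1) => /=.
apply: cvgMl; apply: cvgD; first exact: cvg_cst.
exact: ternary_code_cvg.
Qed.

Lemma measurable_ternary_code d (T : measurableType d) (b : nat -> T -> bool) :
  (forall j, measurable_fun setT (b j)) ->
  measurable_fun setT (fun t => ternary_code (b ^~ t)).
Proof.
move=> mb; apply: (@measurable_fun_cvg _ _ _ setT (fun k t => ternary_partial k (b ^~ t))).
  move=> k; elim: k b mb => [|k IH] b mb //=.
  apply: measurable_funM => //; apply: measurable_funD; last first.
    exact: (IH (fun j => b j.+1)).
  by apply: (@measurableT_comp _ _ _ _ _ _ (fun c : bool => c%:R : R)) => //; exact: mb.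
by move=> t _; exact: ternary_code_cvg.
Qed.

Definition ternary_shift (x : R) : R := 3 * x - (3^-1 <= x)%R%:R.

Definition ternary_digit (j : nat) (x : R) : bool :=
  3^-1 <= iter j ternary_shift x.

Lemma ternary_codeK b j : ternary_digit j (ternary_code b) = b j.
Proof.
have first_digit b' : (3^-1 <= ternary_code b') = b' 0%N.
  rewrite ternary_codeS; have /andP[] := ternary_code_bound (b' \o S).
  by case: (b' 0%N) => /= ? ?; [apply/idP|apply/negbTE; rewrite -ltNge]; lra.
have shiftE b' : ternary_shift (ternary_code b') = ternary_code (b' \o S).
  by rewrite /ternary_shift first_digit ternary_codeS; field.
rewrite /ternary_digit; elim: j b => [|j IH] b; first exact: first_digit.
by rewrite iterSr shiftE IH.
Qed.

Lemma measurable_ternary_digit j : measurable_fun setT (ternary_digit j).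
Proof.
have mge : measurable_fun setT (fun x : R => 3^-1 <= x).
  exact: measurable_fun_ler.
have mshift : measurable_fun setT ternary_shift.
  apply: measurable_funB; first exact: measurable_funM.
  by apply: (@measurableT_comp _ _ _ _ _ _ (fun c : bool => c%:R : R)).
apply: (measurableT_comp mge); elim: j => [|j IH]; first exact: measurable_id.
exact: measurableT_comp mshift IH.
Qed.

End ternary_code.

(** The bits are the answers to [y i t < q] for [i] in [I] and [q] rational. The decoder returns the
    supremum of the rationals whose answer is negative, a countable supremum and hence
    measurable. *)
Lemma real_family_code d (T : measurableType d) (R : realType) (I : countType)
  (y : I -> T -> R) : (forall i, measurable_fun setT (y i)) ->
  exists (phi : T -> R) (dec : I -> R -> R),
    [/\ measurable_fun setT phi, forall t, 0 <= phi t <= 1,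
        forall i, measurable_fun setT (dec i) & forall i t, dec i (phi t) = y i t].
Proof.
move=> my.
pose b (j : nat) t := if unpickle j is Some (i, q) then y i t < ratr (q : rat) else false.
have mb j : measurable_fun setT (b j).
  rewrite /b; case: (unpickle j) => [[i q]|//].
  exact: measurable_fun_ltr.
pose phi t : R := ternary_code R (b ^~ t).
(* The value [-oo] is neutral in the supremum: it serves for the rationals above [y i t] and for the
   numbers [m] that code no rational. *)
pose v (i : I) (m : nat) (x : R) : \bar R :=
  if unpickle m is Some q then
    if ternary_digit (pickle (i, q : rat)) x then -oo%E else (ratr q)%:E
  else -oo%E.
exists phi, (fun i x => fine (esups (v i ^~ x) 0%N)); split.
- exact: measurable_ternary_code.
- move=> t; have /andP[-> /le_trans] := ternary_code_bound R (b ^~ t); apply.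
  by lra.
- move=> i; apply: measurableT_comp => //; apply: measurable_fun_esups => m.
  rewrite /v; case: (unpickle m) => [q|//].
  by apply: measurable_fun_ifT => //; exact: measurable_ternary_digit.
move=> i t; rewrite (_ : esups _ _ = (y i t)%:E)//.
have vE q : v i (pickle q) (phi t) = if y i t < ratr q then -oo%E else (ratr q)%:E.
  by rewrite /v pickleK /phi ternary_codeK /b pickleK.
apply/eqP; rewrite eq_le; apply/andP; split.
  apply: ub_ereal_sup => _ [m _ <-]; rewrite /v.
  case: (unpickle m) => [q|]; last by rewrite leNye.
  rewrite /phi ternary_codeK /b pickleK; case: ltP => [_|]; first by rewrite leNye.
  by rewrite lee_fin.
apply/lee_subgt0Pr => e e0.
have [q] : exists q : rat, ratr q \in `]y i t - e, y i t[.
  by apply: rat_in_itvoo; rewrite ltrBlDr ltrDl.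
rewrite in_itv/= => /andP[q1 q2].
apply: (@le_trans _ _ (ratr q)%:E); first by rewrite -EFinB lee_fin ltW.
apply: ereal_sup_ubound; exists (pickle q) => //=.
by rewrite vE ltNge (ltW q2).
Qed.

(** * Extension of functions from rational to real times *)

Section time_lemmas.
Context (R : realType).

Lemma time_val_ge0 (t : time R) : 0 <= time_val t.
Proof. by have := valP t; rewrite inE/= in_itv/= andbT. Qed.

Lemma totimeK (x : R) : 0 <= x -> time_val (totime x) = x.
Proof. by move=> x0; rewrite /time_val/= max_r. Qed.

Lemma time_valK (t : time R) : totime (time_val t) = t.
Proof. by apply: val_inj; rewrite /= max_r// time_val_ge0. Qed.

Lemma totime_continuous : continuous (@totime R).
Proof.
apply: (continuous_comp_initial (w := set_val)) => x.
by apply: (@continuous_max _ _ (cst 0) id); [exact: cvg_cst|exact: cvg_id].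
Qed.

Lemma time_val_continuous : continuous (@time_val R).
Proof. exact: initial_continuous. Qed.

End time_lemmas.

Section rational_extension.
Context (R : realType).
Local Notation r := (@ratr R).

(* Uniform continuity on bounded sets, with all quantifiers countable. *)
Definition rat_unif_cont (h : rat -> R) := forall T M : nat, exists N : nat,
  forall p q : rat, 0 <= p -> 0 <= q -> r p <= T%:R -> r q <= T%:R ->
    `|r p - r q| <= N.+1%:R^-1 -> `|h p - h q| <= M.+1%:R^-1.

(** Approximation from below: the value at time [s] is a limit of values at rational times that do
    not exceed [s], which keeps the limit measurable with respect to the past. *)
Definition floor_rat (s : R) (j : nat) : rat :=
  (Num.truncn (s * j.+1%:R))%:R / j.+1%:R.

Definition rat_ext (h : rat -> R) (s : R) : R := limn (fun j => h (floor_rat s j)).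

Lemma floor_rat_ge0 s j : 0 <= floor_rat s j.
Proof. by rewrite divr_ge0. Qed.

Lemma floor_rat_itv s j : 0 <= s -> r (floor_rat s j) <= s < r (floor_rat s j) + j.+1%:R^-1.
Proof.
move=> s0; have sj : 0 <= s * j.+1%:R by rewrite mulr_ge0.
have /andP[t1 t2] := truncn_itv sj.
rewrite /floor_rat fmorph_div/= !ratr_nat -[X in _ + X]mul1r -mulrDl ler_pdivrMr// ltr_pdivlMr//.
by rewrite t1/= natr1.
Qed.

Lemma floor_rat_dist s j : 0 <= s -> `|s - r (floor_rat s j)| <= j.+1%:R^-1.
Proof.
move=> /(floor_rat_itv j)/andP[h1 h2]; rewrite ger0_norm ?subr_ge0//.
by rewrite lerBlDl ltW.
Qed.

Lemma invn_small (e : R) : 0 < e -> exists N, forall j, (N <= j)%N -> j.+1%:R^-1 <= e.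
Proof.
move=> e0; have [N Ne] := ltr_add_invr (y := 0) e0; rewrite add0r in Ne.
exists N => j Nj; apply: le_trans (ltW Ne).
by rewrite lef_pV2 ?posrE// ler_nat.
Qed.

Lemma nat_bound (s : R) : exists T : nat, s <= T%:R.
Proof.
by exists (Num.truncn `|s|).+1; rewrite (le_trans (ler_norm s))// ltW// truncnS_gt.
Qed.

Lemma floor_rat_cvg s : 0 <= s -> r (floor_rat s j) @[j --> \oo] --> s.
Proof.
move=> s0; apply/cvgrPdist_le => e /invn_small[N NE].
by exists N => // j /= Nj; exact: le_trans (floor_rat_dist j s0) (NE _ Nj).
Qed.

Section extension.
Context (h : rat -> R) (hc : rat_unif_cont h).

Lemma rat_ext_cvg s : 0 <= s -> h (floor_rat s j) @[j --> \oo] --> rat_ext h s.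
Proof.
move=> s0; suff : cvgn (fun j => h (floor_rat s j)) by [].
have [T sT] := nat_bound s.
apply/cauchy_cvgP/cauchy_exP => e e0.
have [M ME] := invn_small (e := e / 2) (divr_gt0 e0 (ltr0Sn _ 1)).
have [N hN] := hc T M.
have N20 : 0 < N.+1%:R^-1 / 2 :> R by rewrite divr_gt0.
have [K KE] := invn_small N20.
exists (h (floor_rat s K)), K => // j /= Kj.
rewrite /ball/=; apply: (@le_lt_trans _ _ M.+1%:R^-1); last first.
  by rewrite (le_lt_trans (ME _ (leqnn M)))// ltr_pdivrMr// ltr_pMr// ltr1n.
have le i : r (floor_rat s i) <= T%:R.
  by have /andP[/le_trans->] := floor_rat_itv i s0.
apply: hN; rewrite ?floor_rat_ge0 ?le//.
have := floor_rat_dist j s0; have := floor_rat_dist K s0.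
have := KE _ Kj; have := KE _ (leqnn K).
move: (N.+1%:R^-1) (K.+1%:R^-1) (j.+1%:R^-1) (r _) (r _) => a b c x y *.
by rewrite distrC -(subrKA s) (le_trans (ler_normD _ _))// distrC; lra.
Qed.

Lemma rat_ext_unif (T M : nat) : exists2 d : R, 0 < d & forall s t,
  0 <= s <= T%:R -> 0 <= t <= T%:R -> `|s - t| <= d ->
  `|rat_ext h s - rat_ext h t| <= M.+1%:R^-1.
Proof.
have [N hN] := hc T M.
have N20 : 0 < N.+1%:R^-1 / 2 :> R by rewrite divr_gt0.
(* One half of the modulus is for [s - t]; each of the two approximations by [floor_rat] takes a
   quarter. *)
exists (N.+1%:R^-1 / 2) => // s t /andP[s0 sT] /andP[t0 tT] st.
have cst : `|h (floor_rat s j) - h (floor_rat t j)| @[j --> \oo] -->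
    `|rat_ext h s - rat_ext h t|.
  by apply: cvg_norm; apply: cvgB; exact: rat_ext_cvg.
rewrite -(cvg_lim (@Rhausdorff R) cst); apply: limr_le.
  by apply/cvg_ex; eexists; exact: cst.
have N40 : 0 < N.+1%:R^-1 / 4 :> R by rewrite divr_gt0.
have [K KE] := invn_small N40.
exists K => // j /= Kj.
have le u i : 0 <= u -> u <= T%:R -> r (floor_rat u i) <= T%:R.
  by move=> u0; have /andP[/le_trans h1 _] := floor_rat_itv i u0; exact: h1.
apply: hN; rewrite ?floor_rat_ge0 ?le//.
have := floor_rat_dist j s0; have := floor_rat_dist j t0; have := KE _ Kj.
move: st; move: (N.+1%:R^-1) (j.+1%:R^-1) (r _) (r _) => a b x y.
by rewrite !ler_norml => st bb tt ss; lra.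
Qed.

Lemma rat_ext_continuous (f : time R -> R) :
  (forall t, f t = rat_ext h (time_val t)) -> continuous f.
Proof.
move=> fE t; apply/cvgrPdist_le; first exact: (@nbhs_filter (time R) t).
move=> e /invn_small[M /(_ _ (leqnn M)) ME].
have [T tT] := nat_bound (time_val t + 1).
have [d d0 hd] := rat_ext_unif T M.
have ct : {for t, continuous (@time_val R)} by exact: time_val_continuous.
have dm0 : 0 < Num.min d 1 by rewrite lt_min d0 ltr01.
move/cvgrPdist_le : ct => /(_ _ dm0); apply: filterS => u; rewrite le_min => /andP[tu tu1].
rewrite !fE (le_trans _ ME)// hd// ?time_val_ge0//=; first by lra.
move: tu1; rewrite ler_norml; lra.
Qed.

End extension.

(** Only [x] is confined to [K]. For a compactly supported function this gives a modulus of
    continuity on the whole plane. *)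
Lemma compact_unif_continuous (U V : pseudoMetricType R) (K : set U) (f : U -> V) :
  compact K -> continuous f -> forall e : R, 0 < e -> exists2 d : R, 0 < d &
    forall x y, K x -> ball x d y -> ball (f x) e (f y).
Proof.
move=> cK cf e e0.
have h : \forall d \near 0^'+, K `<=` [set x | forall y, ball x d y -> ball (f x) e (f y)].
  apply: ((compact_near_coveringP K).1 cK R (0%R^'+)
    (fun d x => forall y, ball x d y -> ball (f x) e (f y))) => x Kx.
  have e20 : 0 < e / 2 by rewrite divr_gt0.
  have : nbhs x [set y | ball (f x) (e / 2) (f y)].
    by have := cf x => /(_ (ball (f x) (e / 2))); apply; exact: nbhsx_ballx.
  move=> /nbhs_ballP[d /= d0 hd].
  have d20 : 0 < d / 2 by rewrite divr_gt0.
  exists (ball x (d / 2), [set d' | d' <= d / 2]) => /=.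
    split; first exact: nbhsx_ballx.
    by near=> d'; near: d'; exact: nbhs_right_le.
  move=> [y d'] [/= xy d'd] z yz.
  rewrite (splitr e); apply: (@ball_triangle _ _ (f x)).
    apply: ball_sym; apply: hd; apply: le_ball xy.
    by rewrite ler_pdivrMr// ler_peMr// ?ler1n// ltW.
  apply: hd; rewrite (splitr d); apply: ball_triangle xy _.
  exact: le_ball yz.
have : \forall d \near 0^'+, 0 < d /\ forall x, K x -> forall y, ball x d y -> ball (f x) e (f y).
  near=> d; split; near: d; first exact: nbhs_right_gt.
  exact: h.
by move=> /filter_ex[d [d0 hd]]; exists d => // x y Kx; exact: hd.
Unshelve. all: by end_near. Qed.

End rational_extension.

Lemma countable_bigcapT_measurable d (T : measurableType d) (I : countType)
  (F : I -> set T) : (forall i, measurable (F i)) -> measurable (\bigcap_i F i).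
Proof.
move=> mF; rewrite -(setCK (\bigcap_i F i)) setC_bigcap; apply: measurableC.
by apply: countable_bigcupT_measurable => // i; exact: measurableC.
Qed.

Lemma cvg_seq_ge (R : realType) (u : nat -> R) (l a : R) :
  u @ \oo --> l -> (forall j, a <= u j) -> a <= l.
Proof.
move=> ul au; rewrite -(cvg_lim (@Rhausdorff R) ul).
by apply: limr_ge; [apply/cvg_ex; exists l|exact: nearW].
Qed.

(** * Coding of continuous paths in the open cone *)

Section open_cone_paths.
Context (R : realType) (n : nat) (lam : nat -> R) (hlam : spectrum n lam).
Local Notation lamN := (lam (2 * n)%N).
Local Notation open_cone := (open_cone hlam).
Local Notation path_space := (path_space hlam).

(** Moving [v] or [u] up by half the radius of a ball inside the cone makes the inequalities strict.
    Conversely [v < u < lamN * v] with [lamN > 1] forces [v > 0], so two open conditions suffice. *)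
Lemma cone_interiorP (w : R * R) :
  (cone n lam)° w <-> w.2 < w.1 /\ w.1 < lamN * w.2.
Proof.
have lam1 := lamN_gt1 hlam; split.
  rewrite /interior => /nbhs_ballP[e /= e0 he].
  have e20 : 0 < e / 2 by rewrite divr_gt0.
  have ee : e / 2 < e by rewrite ltr_pdivrMr// ltr_pMr// ltr1n.
  split.
    have [|_ /= h _] := he (w.1, w.2 + e / 2); last by lra.
    split => /=; first exact: ballxx.
    by rewrite /ball/= opprD addrA subrr add0r normrN gtr0_norm.
  have [|_ _ /= h] := he (w.1 + e / 2, w.2); last by lra.
  split => /=; last exact: ballxx.
  by rewrite /ball/= opprD addrA subrr add0r normrN gtr0_norm.
move=> [w21 w12].
have oP (f : R * R -> R) : continuous f -> open [set w | 0 < f w].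
  by move=> cf; apply: (open_comp (D := [set x : R | 0 < x])) => [x _|];
    [exact: cf|exact: open_gt].
pose U := [set w : R * R | 0 < w.1 - w.2] `&` [set w | 0 < lamN * w.2 - w.1].
have oU : open U.
  apply: openI; apply: oP => x.
  - by apply: cvgB; [exact: cvg_fst|exact: cvg_snd].
  - by apply: cvgB; [apply: cvgMr; exact: cvg_snd|exact: cvg_fst].
have UC : U `<=` (cone n lam)°.
  rewrite -open_subsetE// => x [/=]; rewrite !subr_gt0 => x21 x12.
  have x0 : 0 < x.2.
    by rewrite -(@pmulr_rgt0 _ (lamN - 1)) ?subr_gt0// mulrBl mul1r; lra.
  by rewrite /cone/=; split; lra.
by apply: UC; split => /=; rewrite subr_gt0.
Qed.

Lemma cone_val_interior (w : open_cone) : (cone n lam)° (cone_val w).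
Proof. exact: set_mem (valP w). Qed.

Lemma cone_val_inj : injective (@cone_val _ _ _ hlam).
Proof. exact: val_inj. Qed.

Lemma cone_val_continuous : continuous (@cone_val _ _ _ hlam).
Proof. exact: initial_continuous. Qed.

Lemma measurable_cone_val : measurable_fun setT (@cone_val _ _ _ hlam).
Proof. by move=> _ B mB; exists B. Qed.

Lemma measurable_to_cone d (X : measurableType d) (f : X -> open_cone) :
  measurable_fun setT (fun x => (cone_val (f x)).1) ->
  measurable_fun setT (fun x => (cone_val (f x)).2) ->
  measurable_fun setT f.
Proof.
move=> m1 m2 _ _ [B mB <-]; rewrite !setTI.
have mf : measurable_fun setT (fun x => cone_val (f x)).
  rewrite (_ : (fun x => _) = (fun x => ((cone_val (f x)).1, (cone_val (f x)).2))).
    exact: measurable_fun_pair.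
  by apply/funext => x; rewrite -surjective_pairing.
exact: (measurable_preimageT mf mB).
Qed.

Lemma measurable_path_eval (t : time R) :
  measurable_fun setT (fun W : path_space => W t).
Proof.
move=> _ B mB; rewrite setTI; apply: sub_sigma_algebra.
by exists t, B.
Qed.

Definition path_coord (b : bool) (t : time R) (W : path_space) : R :=
  if b then (cone_val (W t)).1 else (cone_val (W t)).2.

Lemma measurable_path_coord b t : measurable_fun setT (path_coord b t).
Proof.
have m := measurableT_comp measurable_cone_val (measurable_path_eval t).
rewrite /path_coord; case: b.
  exact: (measurableT_comp (@measurable_fst _ _ _ _) m).
exact: (measurableT_comp (@measurable_snd _ _ _ _) m).
Qed.

Lemma measurable_to_path d (X : measurableType d) (G : X -> path_space) :
  (forall b t, measurable_fun setT (fun x => path_coord b t (G x))) ->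
  measurable_fun setT G.
Proof.
move=> mG; apply: (measurability (@path_generators _ _ _ hlam)) => //.
move=> _ [_ [t [B mB ->]] <-]; rewrite setTI.
have mGt : measurable_fun setT (fun x => G x t).
  by apply: measurable_to_cone; [exact: (mG true t)|exact: (mG false t)].
exact: (measurable_preimageT mGt mB).
Qed.

Lemma path_coord_continuous b W : continuous (fun s : R => path_coord b (totime s) W).
Proof.
move=> s; rewrite /path_coord.
have c : {for s, continuous (fun s => cone_val (W (totime s)))}.
  apply: (@continuous_comp _ _ _ (fun s => W (totime s)) (@cone_val _ _ _ hlam)).
    apply: (@continuous_comp _ _ _ (@totime R) W); first exact: totime_continuous.
    exact: cts_fun.
  exact: cone_val_continuous.
case: b; apply: (@continuous_comp _ _ _ (fun s => cone_val (W (totime s))) _ _ c).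
- exact: cvg_fst.
- exact: cvg_snd.
Qed.

Lemma path_coord_in W t : path_coord false t W < path_coord true t W /\
  path_coord true t W < lamN * path_coord false t W.
Proof. exact: (cone_interiorP _).1 (cone_val_interior (W t)). Qed.

Lemma path_ext (W W' : path_space) : (forall b t, path_coord b t W = path_coord b t W') ->
  W = W'.
Proof.
move=> h; apply/continuousEP => t; apply: cone_val_inj.
rewrite [LHS]surjective_pairing [RHS]surjective_pairing.
by congr pair; [exact: (h true t)|exact: (h false t)].
Qed.

(* The second condition keeps the extension of [y] to real times away from the
   boundary of the cone on bounded time intervals. *)
Definition rat_path (y : bool -> rat -> R) : Prop :=
  (forall b, rat_unif_cont (y b)) /\
  forall T : nat, exists M : nat, forall q : rat, 0 <= q -> ratr q <= T%:R :> R ->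
    M.+1%:R^-1 <= y true q - y false q /\
    M.+1%:R^-1 <= lamN * y false q - y true q.

Lemma path_rat_path W : rat_path (fun b q => path_coord b (totime (ratr q)) W).
Proof.
have cb T : compact (`[0, T%:R] : set R) by exact: segment_compact.
split.
  move=> b T M.
  have M0 : 0 < M.+1%:R^-1 :> R by rewrite invr_gt0.
  have [d d0 hd] := compact_unif_continuous (cb T)
    (@path_coord_continuous b W) M0.
  have [N NE] := ltr_add_invr (y := 0) d0; rewrite add0r in NE.
  exists N => p q p0 q0 pT qT pq; apply/ltW.
  have := hd (ratr p) (ratr q); apply.
    by rewrite /= in_itv/= ler0q p0.
  by rewrite /ball/= (le_lt_trans pq).
move=> T.
have T0 : 0 <= T%:R :> R by [].
(* A positive continuous function has a positive minimum on [[0, T]]. Every [M'] beyond [M] is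
   allowed, so that the two sides of the cone can share the larger bound. *)
have key (f : R -> R) : continuous f -> (forall s, 0 < f s) ->
    exists M : nat, forall s, 0 <= s <= T%:R -> forall M', (M <= M')%N -> M'.+1%:R^-1 <= f s.
  move=> cf f0; have [c _ hc] := EVT_min T0 (continuous_subspaceT cf).
  have [M ME] := invn_small (f0 c).
  exists M => s s0T M' MM'; apply: (le_trans (ME _ MM')); apply: hc.
  by rewrite in_itv.
have [M1 h1] := key (fun s => path_coord true (totime s) W - path_coord false (totime s) W)
  (fun s => cvgB (@path_coord_continuous true W s) (@path_coord_continuous false W s))
  (fun s => ltac:(by rewrite subr_gt0; have [] := path_coord_in W (totime s))).
have [M2 h2] := key (fun s => lamN * path_coord false (totime s) W - path_coord true (totime s) W)
  (fun s => cvgB (cvgMr (@path_coord_continuous false W s)) (@path_coord_continuous true W s))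
  (fun s => ltac:(by rewrite subr_gt0; have [] := path_coord_in W (totime s))).
exists (maxn M1 M2) => q q0 qT.
by split; [apply: h1|apply: h2]; rewrite ?ler0q ?q0 ?leq_maxl ?leq_maxr.
Qed.

(** The strict inequalities of the open cone survive the passage to the limit because they hold with
    a margin [1/(M+1)] on each [[0, T]]. *)
Lemma rat_path_extension y : rat_path y -> exists W : path_space,
  forall b s, 0 <= s -> path_coord b (totime s) W = rat_ext (y b) s.
Proof.
move=> [yc yC].
have inC s : 0 <= s -> (cone n lam)° (rat_ext (y true) s, rat_ext (y false) s).
  move=> s0; have [T sT] := nat_bound s; have [M hM] := yC T.
  have M0 : 0 < M.+1%:R^-1 :> R by rewrite invr_gt0.
  have c1 := rat_ext_cvg (yc true) s0; have c2 := rat_ext_cvg (yc false) s0.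
  have le i : ratr (floor_rat s i) <= T%:R :> R.
    by have /andP[/le_trans->] := floor_rat_itv i s0.
  have c3 : y true (floor_rat s j) - y false (floor_rat s j) @[j --> \oo] -->
    rat_ext (y true) s - rat_ext (y false) s by apply: cvgB.
  have c4 : lamN * y false (floor_rat s j) - y true (floor_rat s j) @[j --> \oo] -->
    lamN * rat_ext (y false) s - rat_ext (y true) s by apply: cvgB => //; exact: cvgMr.
  apply/cone_interiorP => /=; split; rewrite -subr_gt0; apply: (lt_le_trans M0).
    by apply: (cvg_seq_ge c3) => j; have [] := hM (floor_rat s j) (floor_rat_ge0 s j) (le j).
  by apply: (cvg_seq_ge c4) => j; have [] := hM (floor_rat s j) (floor_rat_ge0 s j) (le j).
pose F (t : time R) : open_cone :=
  exist (fun w => w \in ((cone n lam)° : set (R * R))) _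
    (mem_set (inC _ (time_val_ge0 t))).
have cF : continuous F.
  apply: (continuous_comp_initial (w := @cone_val _ _ _ hlam)) => t.
  have FF : Filter (nbhs t) by exact: (@nbhs_filter (time R) t).
  have h1 := rat_ext_continuous (yc true) (fun=> erefl) (x := t).
  have h2 := rat_ext_continuous (yc false) (fun=> erefl) (x := t).
  exact: (cvg_pair (H := nbhs _) h1 h2).
exists [the continuousType _ _ of mkcts cF] => b s s0.
by rewrite /path_coord /=; case: b; rewrite -[in RHS](totimeK s0).
Qed.

Lemma measurable_rat_path d (X : measurableType d) (y : bool -> rat -> X -> R) :
  (forall b q, measurable_fun setT (y b q)) ->
  measurable [set x | rat_path (fun b q => y b q x)].
Proof.
move=> my; apply: measurableI.
  rewrite [Z in measurable Z](_ : _ = \bigcap_b \bigcap_T \bigcap_M \bigcup_N \bigcap_(p : rat) \bigcap_(q : rat)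
    [set x | 0 <= p -> 0 <= q -> ratr p <= T%:R :> R -> ratr q <= T%:R :> R ->
    `|ratr p - ratr q| <= N.+1%:R^-1 :> R -> `|y b p x - y b q x| <= M.+1%:R^-1 ]); last first.
    apply/seteqP; split => x /=.
      by move=> h b _ T _ M _; have [N hN] := h b T M; exists N => // p _ q _; exact: hN.
    move=> h b T M; have [N _ hN] := h b I T I M I; exists N => p q; exact: hN.
  apply: countable_bigcapT_measurable => // b.
  apply: bigcapT_measurable => T; apply: bigcapT_measurable => M.
  apply: bigcupT_measurable => N.
  apply: countable_bigcapT_measurable => // p; apply: countable_bigcapT_measurable => // q.
  have [c|c] := pselect [/\ 0 <= p, 0 <= q, ratr p <= T%:R :> R, ratr q <= T%:R :> R &
    `|ratr p - ratr q| <= N.+1%:R^-1 :> R].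
    rewrite [Z in measurable Z](_ : _ = [set x | `|y b p x - y b q x| <= M.+1%:R^-1]).
      apply: measurable_set_ler => //; apply: measurableT_comp => //.
      exact: measurable_funB.
    by apply/seteqP; split => x /=; case: c => ? ? ? ? ?; [exact|].
  rewrite [Z in measurable Z](_ : _ = setT)//; apply/seteqP; split => // x _ /= *.
  by exfalso; apply: c.
rewrite [Z in measurable Z](_ : _ = \bigcap_T \bigcup_M \bigcap_(q : rat)
    [set x | 0 <= q -> ratr q <= T%:R :> R ->
      M.+1%:R^-1 <= y true q x - y false q x /\
      M.+1%:R^-1 <= lamN * y false q x - y true q x]); last first.
  apply/seteqP; split => x /=.
    by move=> h T _; have [M hM] := h T; exists M => // q _; exact: hM.
  by move=> h T; have [M _ hM] := h T I; exists M => q; exact: hM.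
apply: bigcapT_measurable => T; apply: bigcupT_measurable => M.
apply: countable_bigcapT_measurable => // q.
have [c|c] := pselect (0 <= q /\ ratr q <= T%:R :> R).
  rewrite [Z in measurable Z](_ : _ = [set x | M.+1%:R^-1 <= y true q x - y false q x] `&`
      [set x | M.+1%:R^-1 <= lamN * y false q x - y true q x]).
    apply: measurableI; apply: measurable_set_ler => //; first exact: measurable_funB.
    by apply: measurable_funB => //; exact: measurable_funM.
  by apply/seteqP; split => x /=; case: c => ? ?; [exact|].
rewrite [Z in measurable Z](_ : _ = setT)//; apply/seteqP; split => // x _ /= *.
by exfalso; apply: c.
Qed.

(** Data that do not come from a path are sent to the constant path [point]; they form a measurable
    set. Elsewhere each coordinate of [G x] at a real time is a limit of values at rational
    times. *)
Lemma measurable_path_extension d (X : measurableType d) (y : bool -> rat -> X -> R) :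
  (forall b q, measurable_fun setT (y b q)) ->
  exists G : X -> path_space, measurable_fun setT G /\
    forall x W, (forall b q, path_coord b (totime (ratr q)) W = y b q x) -> G x = W.
Proof.
move=> my.
have /choice[g hg] (z : bool -> rat -> R) : exists W : path_space, rat_path z ->
    forall b s, 0 <= s -> path_coord b (totime s) W = rat_ext (z b) s.
  have [/rat_path_extension[W hW]|nz] := pselect (rat_path z); first by exists W.
  by exists point.
pose S := [set x | rat_path (fun b q => y b q x)].
pose G x := if x \in S then g (fun b q => y b q x) else point.
have mS : measurable S by exact: measurable_rat_path.
exists G; split.
  apply: measurable_to_path => b t.
  rewrite (_ : (fun x => _) = (fun x => if x \in S then rat_ext (fun q => y b q x) (time_val t)
      else path_coord b t point)); last first.
    apply/funext => x; rewrite /G; case: ifPn => // /set_mem Sx.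
    by rewrite -{1}(time_valK t) (hg _ Sx)// time_val_ge0.
  apply: measurable_fun_if => //.
  - by apply: (measurable_fun_bool true); rewrite setTI preimage_mem_true.
  - rewrite setTI preimage_mem_true.
    apply: (@measurable_fun_cvg _ _ _ S (fun j x => y b (floor_rat (time_val t) j) x)).
      by move=> j; exact: measurable_funTS.
    by move=> x [Sx _]; apply: rat_ext_cvg => //; exact: time_val_ge0.
move=> x W hW.
have yE : (fun b q => path_coord b (totime (ratr q)) W) = (fun b q => y b q x).
  by apply/funext => b; apply/funext => q; exact: hW.
have Sx : S x by rewrite /S/= -yE; exact: path_rat_path.
rewrite /G mem_set//; apply: path_ext => b t; rewrite -(time_valK t).
have t0 := time_val_ge0 t.
rewrite -yE (hg _ (path_rat_path W))//.
have c1 := rat_ext_cvg ((path_rat_path W).1 b) t0.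
apply: (cvg_unique (@Rhausdorff R) c1).
have : path_coord b (totime s) W @[s --> time_val t] --> path_coord b (totime (time_val t)) W.
  exact: path_coord_continuous.
by move=> /(cvg_comp _ _ (floor_rat_cvg t0)).
Qed.

Lemma path_space_retract : exists (phi : path_space -> R) (g : R -> path_space),
  [/\ measurable_fun setT phi, measurable_fun setT g,
      forall W, 0 <= phi W <= 1 & cancel phi g].
Proof.
have [phi [dec [mphi phi01 mdec decK]]] := @real_family_code _ path_space R (bool * rat)%type
  (fun i => path_coord i.1 (totime (ratr i.2))) (fun i => @measurable_path_coord _ _).
have [g [mg gK]] := @measurable_path_extension _ _ (fun b q => dec (b, q)) (fun b q => mdec _).
exists phi, g; split => // W; apply: gK => b q.
by rewrite decK.
Qed.

End open_cone_paths.

(** * The generator on test functions *)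

Section generator_coefficients.
Context (R : realType) (n : nat) (lam : nat -> R) (hlam : spectrum n lam).
Local Notation RT := (measurableTypeR R).

Lemma mu_gt1 i : (2 <= i <= n)%N -> 1 < mu lam i.
Proof.
have n4 := spectrum_n_ge4 hlam.
elim: i => [//|[//|[_ _|k IHk /andP[_ ltkn]]]].
  by rewrite -(mu1 hlam); apply: (mu_lt hlam); rewrite (leq_trans _ n4).
have le2n : (2 <= k.+2 <= n)%N by rewrite /= ltnW.
by apply: (lt_trans (IHk le2n)); apply: (mu_lt hlam).
Qed.

Lemma measurable_inv : measurable_fun setT (fun x : R => x^-1).
Proof.
have mD : measurable [set x : R | x != 0].
  rewrite (_ : mkset _ = ~` [set 0]); first exact: measurableC.
  by apply/seteqP; split => x /= /eqP.
rewrite (_ : setT = [set x : R | x != 0] `|` [set 0]); last first.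
  by apply/seteqP; split => // x _ /=; have [->|] := eqVneq x 0; [right|left].
apply/measurable_funU => //; split.
  apply: open_continuous_measurable_fun.
    exact: open_neq.
  by move=> x; rewrite inE/= => x0; exact: inv_continuous.
exact: measurable_fun_set1.
Qed.

Lemma measurable_entry i : measurable_fun setT (fun s : (n - 2).-tuple RT => entry s i).
Proof.
rewrite /entry; have [h|h] := ltnP (i - 3) (n - 2).
  rewrite (_ : (fun s => _) = (fun s : (n - 2).-tuple RT => tnth s (Ordinal h))).
    exact: measurable_tnth.
  by apply/funext => s; rewrite (tnth_nth 0).
rewrite (_ : (fun s => _) = cst 0)//.
by apply/funext => s; rewrite nth_default// size_tuple.
Qed.

(** Measurability jointly in [(w, s)] is what lets Tonelli's theorem handle integrals over a
    polytope that varies with [w]. *)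
Lemma measurable_polytope_graph :
  measurable [set x : (R * R) * (n - 2).-tuple RT | polytope lam x.1 x.2].
Proof.
have mE i : measurable_fun setT (fun x : (R * R) * (n - 2).-tuple RT => entry x.2 i).
  exact: (measurableT_comp (measurable_entry i)).
have mu' : measurable_fun setT (fun x : (R * R) * (n - 2).-tuple RT => x.1.1).
  exact: (measurableT_comp (@measurable_fst _ _ _ _)).
have mv : measurable_fun setT (fun x : (R * R) * (n - 2).-tuple RT => x.1.2).
  exact: (measurableT_comp (@measurable_snd _ _ _ _)).
have msum (k : nat) : measurable_fun setT (fun x : (R * R) * (n - 2).-tuple RT =>
    \sum_(3 <= i < n.+1) (1 - mu lam k / mu lam i) * entry x.2 i).
  by apply: measurable_sum => i; apply: measurable_funM.
rewrite (_ : mkset _ =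
  (\bigcap_(i : nat) [set x | (3 <= i <= n)%N -> 0 <= entry x.2 i]) `&`
  ([set x | \sum_(3 <= i < n.+1) (1 - mu lam 1 / mu lam i) * entry x.2 i <= x.1.1 - mu lam 1 * x.1.2] `&`
   [set x | \sum_(3 <= i < n.+1) (1 - mu lam 2 / mu lam i) * entry x.2 i >= x.1.1 - mu lam 2 * x.1.2])); last first.
  apply/seteqP; split => x /=; first by case=> h1 h2 h3; split=> // i _; exact: h1.
  by case=> h1 [h2 h3]; split => // i; exact: h1.
apply: measurableI.
  apply: bigcapT_measurable => i; have [i3|i3] := boolP (3 <= i <= n)%N.
    rewrite (_ : mkset _ = [set x | 0 <= entry x.2 i]); first exact: measurable_set_ler.
    by apply/seteqP; split => x /=; [exact|].
  by rewrite (_ : mkset _ = setT)//; apply/seteqP; split.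
apply: measurableI; apply: measurable_set_ler => //; apply: measurable_funB => //.
  exact: measurable_funM.
exact: measurable_funM.
Qed.

Lemma measurable_polytope w : measurable (@polytope R n lam w).
Proof.
have := measurable_xsection w measurable_polytope_graph.
rewrite (_ : xsection _ _ = polytope lam w)//.
by apply/seteqP; split => s; rewrite /xsection/= inE.
Qed.

(* Coefficients are controlled on [cone n lam] intersected with the half plane
   [w.1 <= m], which bounds [w]. *)
Definition admissible (f : R * R -> R) := measurable_fun setT f /\
  forall m : nat, exists C : R, forall w, cone n lam w -> w.1 <= m%:R -> `|f w| <= C.

Lemma admissible_cst c : admissible (fun=> c).
Proof. by split => // m; exists `|c|. Qed.

Lemma admissibleD f g : admissible f -> admissible g -> admissible (fun w => f w + g w).
Proof.
move=> [mf bf] [mg bg]; split; first exact: measurable_funD.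
move=> m; have [C hC] := bf m; have [D hD] := bg m; exists (C + D) => w cw wm.
by rewrite (le_trans (ler_normD _ _))// lerD// ?hC ?hD.
Qed.

Lemma admissibleM f g : admissible f -> admissible g -> admissible (fun w => f w * g w).
Proof.
move=> [mf bf] [mg bg]; split; first exact: measurable_funM.
move=> m; have [C hC] := bf m; have [D hD] := bg m; exists (C * D) => w cw wm.
by rewrite normrM ler_pM// ?hC ?hD.
Qed.

Lemma admissibleB f g : admissible f -> admissible g -> admissible (fun w => f w - g w).
Proof.
move=> af ag; rewrite (_ : (fun w => _) = (fun w => f w + (-1) * g w)).
  by apply: admissibleD => //; apply: admissibleM => //; exact: admissible_cst.
by apply/funext => w; rewrite mulN1r.
Qed.

Lemma admissible_sum (a b : nat) (f : nat -> R * R -> R) :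
  (forall i, (a <= i < b)%N -> admissible (f i)) ->
  admissible (fun w => \sum_(a <= i < b) f i w).
Proof.
elim: b => [|b IH] af.
  rewrite (_ : (fun w => _) = fun=> 0); first exact: admissible_cst.
  by apply/funext => w; rewrite big_geq.
have [ab|ab] := leqP a b; last first.
  rewrite (_ : (fun w => _) = fun=> 0); first exact: admissible_cst.
  by apply/funext => w; rewrite big_geq.
rewrite (_ : (fun w => _) = fun w => \sum_(a <= i < b) f i w + f b w).
  apply: admissibleD; last by apply: af; rewrite ab ltnSn.
  by apply: IH => i /andP[ai ib]; apply: af; rewrite ai ltnW.
by apply/funext => w; rewrite big_nat_recr.
Qed.

(** All terms of the first constraint are nonnegative, since [mu 1 = 1 < mu j]; keep the one of
    index [i]. *)
Lemma polytope_entry_bound i w (s : (n - 2).-tuple RT) : (3 <= i <= n)%N -> polytope lam w s ->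
  0 <= @entry R n s i <= (w.1 - w.2) / (1 - (mu lam i)^-1).
Proof.
move=> i3n [s0 s1 _]; rewrite s0//=.
have pos j : (3 <= j <= n)%N -> 0 < 1 - (mu lam j)^-1.
  move=> /andP[j3 jn]; rewrite subr_gt0 invf_lt1 ?mu_gt1 ?(ltnW j3)//.
  by rewrite (lt_trans ltr01)// mu_gt1// (ltnW j3).
rewrite ler_pdivlMr ?pos// mulrC.
rewrite (mu1 hlam) mul1r in s1; apply: le_trans s1.
have -> : \sum_(3 <= j < n.+1) (1 - 1 / mu lam j) * entry s j =
    \sum_(3 <= j < n.+1) (1 - (mu lam j)^-1) * entry s j.
  by apply: eq_bigr => j _; rewrite div1r.
rewrite (bigD1_seq i)/=; [|by rewrite mem_index_iota ltnS|exact: iota_uniq].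
rewrite lerDl big_seq_cond; apply: sumr_ge0 => j; rewrite mem_index_iota ltnS => /andP[j3 _].
by rewrite mulr_ge0// ?s0// ltW// pos.
Qed.

Lemma admissible_polytope_mean i : (3 <= i <= n)%N -> admissible (polytope_mean n lam i).
Proof.
move=> i3n; pose leb := @lebesgue_tuple R (n - 2).
pose J := [set x : (R * R) * (n - 2).-tuple RT | polytope lam x.1 x.2].
have mJ : measurable J := measurable_polytope_graph.
have mint (f : (n - 2).-tuple RT -> R) : measurable_fun setT f ->
    (forall w s, polytope lam w s -> 0 <= f s) ->
    measurable_fun setT (fun w => \int[leb]_(s in polytope lam w) (f s)%:E)%E.
  move=> mf f0.
  pose F (x : (R * R) * (n - 2).-tuple RT) : \bar R := if x \in J then (f x.2)%:E else 0%E.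
  have mF : measurable_fun setT F.
    apply: measurable_fun_ifT => //.
      by apply: (measurable_fun_bool true); rewrite setTI preimage_mem_true.
    by apply/measurable_EFinP; exact: measurableT_comp.
  have F0 x : (0 <= F x)%E by rewrite /F; case: ifPn => // /set_mem /f0; rewrite lee_fin.
  have := @measurable_fun_fubini_tonelli_F _ _ _ _ _ leb F mF F0.
  rewrite (_ : fubini_F _ _ = fun w => \int[leb]_(s in polytope lam w) (f s)%:E)%E//.
  apply/funext => w; rewrite /fubini_F [RHS]integral_mkcond; apply: eq_integral => s _.
  rewrite /F patchE (_ : ((w, s) \in J) = (s \in polytope lam w))//.
split.
  apply: measurable_funM.
    apply: measurableT_comp => //; apply: mint; first exact: measurable_entry.
    by move=> w s [+ _ _]; exact.
  apply: (measurableT_comp measurable_inv); apply: measurableT_comp => //.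
  rewrite (_ : (fun w => _) = (fun w => \int[leb]_(s in polytope lam w) 1%:E)%E).
    by apply: (mint (fun=> 1)).
  by apply/funext => w; rewrite integral_cst ?mul1e//; exact: measurable_polytope.
move=> m; have mui : 0 < 1 - (mu lam i)^-1.
  have /andP[i3 ni] := i3n.
  rewrite subr_gt0 invf_lt1 ?mu_gt1 ?(ltnW i3)//.
  by rewrite (lt_trans ltr01)// mu_gt1// (ltnW i3).
exists (m%:R / (1 - (mu lam i)^-1)) => w [w2 w21 w12] wm.
set K := m%:R / _.
have K0 : 0 <= K by rewrite divr_ge0// ltW.
have mP := measurable_polytope w.
have sK (s : (n - 2).-tuple RT) : polytope lam w s -> 0 <= entry s i <= K.
  move=> /(polytope_entry_bound i3n)/andP[-> /le_trans]; apply.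
  by rewrite /K ler_pM2r ?invr_gt0//; lra.
rewrite /polytope_mean; set V := (X in fine X).
have V0 : (0 <= V)%E by exact: measure_ge0.
(* An infinite volume has [fine] value 0, and division by 0 gives 0, so the mean is then 0; the same
   happens below for a volume equal to 0. In the remaining case the entry is at most [K] on the
   polytope, and so is its mean. *)
have [->|Voo] := eqVneq V +oo%E; first by rewrite invr0 mulr0 normr0.
have Vfin : V \is a fin_num by rewrite ge0_fin_numE// ltey.
have num : `|\int[leb]_(s in polytope lam w) entry s i| <= K * fine V.
  have le1 : (\int[leb]_(s in polytope lam w) (entry s i)%:E <= K%:E * V)%E.
    rewrite -integral_cst//; apply: ge0_le_integral => //.
    - by move=> s /sK/andP[]; rewrite lee_fin.
    - by apply/measurable_EFinP; apply: measurable_funTS; exact: measurable_entry.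
    - by move=> s /sK/andP[_]; rewrite lee_fin.
  have ge0 : (0 <= \int[leb]_(s in polytope lam w) (entry s i)%:E)%E.
    by apply: integral_ge0 => s /sK/andP[]; rewrite lee_fin.
  rewrite /Rintegral ger0_norm ?fine_ge0// -lee_fin EFinM !fineK//.
  by rewrite ge0_fin_numE// (le_lt_trans le1)// -(fineK Vfin) -EFinM ltry.
have [V00|V00] := eqVneq (fine V) 0; first by rewrite V00 invr0 mulr0 normr0.
have Vp : 0 < fine V by rewrite lt_neqAle eq_sym V00 fine_ge0.
by rewrite normrM normfV (gtr0_norm Vp) ler_pdivrMr.
Qed.

Lemma admissible_qfun l : (1 <= l <= 2 * n)%N -> admissible (qfun n lam l).
Proof.
move=> /andP[l1 l2n]; rewrite /qfun; apply: admissibleM; last exact: admissible_cst.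
have u1 : (1 <= uphalf l <= n)%N by rewrite uphalf_half; lia.
have a1 : admissible (fst : R * R -> R).
  split; first exact: measurable_fst.
  by move=> m; exists m%:R => w [w2 w21 _] wm; rewrite ger0_norm// (le_trans w2).
have a2 : admissible (snd : R * R -> R).
  split; first exact: measurable_snd.
  by move=> m; exists m%:R => w [w2 w21 _] wm; rewrite ger0_norm// (le_trans w21).
have aA : admissible (fun w => w.1 - \sum_(3 <= j < n.+1) polytope_mean n lam j w).
  by apply: admissibleB => //; apply: admissible_sum => j; exact: admissible_polytope_mean.
have aB : admissible (fun w => w.2 - \sum_(3 <= j < n.+1) (mu lam j)^-1 * polytope_mean n lam j w).
  apply: admissibleB => //; apply: admissible_sum => j j3; apply: admissibleM.
    exact: admissible_cst.
  exact: admissible_polytope_mean.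
rewrite /qhat; case: eqP => [_|h1]; last case: eqP => [_|h2].
- apply: admissibleM; last exact: admissible_cst.
  by apply: admissibleB => //; apply: admissibleM => //; exact: admissible_cst.
- apply: admissibleM; last exact: admissible_cst.
  by apply: admissibleB => //; apply: admissibleM => //; exact: admissible_cst.
- by apply: admissible_polytope_mean; lia.
Qed.

(** Separates coefficients that do not depend on [psi] from five partial derivatives; every estimate
    on the generator is then one on a sum of five products. *)
Lemma generator_coefficients a delta : exists c : seq bool -> R * R -> R,
  (forall s, admissible (c s)) /\ forall psi w, generator n lam a delta psi w =
    \sum_(s <- [:: [:: true; true]; [:: true; false]; [:: false; false]; [:: true]; [:: false]])
      c s w * partial s psi w.
Proof.
have aq (x : nat -> R) : admissible (fun w => \sum_(1 <= l < (2 * n).+1) x l * qfun n lam l w).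
  apply: admissible_sum => l ln; apply: admissibleM; first exact: admissible_cst.
  exact: admissible_qfun.
have aq' : admissible (fun w => \sum_(1 <= l < (2 * n).+1) qfun n lam l w).
  by apply: admissible_sum => l ln; exact: admissible_qfun.
have aM (k : R) f : admissible f -> admissible (fun w => k * f w).
  by move=> ?; apply: admissibleM => //; exact: admissible_cst.
pose S (x : nat -> R) w := \sum_(1 <= l < (2 * n).+1) x l * qfun n lam l w.
pose c (s : seq bool) (w : R * R) : R :=
  if s == [:: true; true] then 2 * a * S (fun l => lam l * (1 + delta l)) w
  else if s == [:: true; false] then 2 * a * (2 * S (fun l => 1 + delta l) w)
  else if s == [:: false; false] then 2 * a * S (fun l => (lam l)^-1 * (1 + delta l)) w
  else if s == [:: true] then
    a * (\sum_(1 <= l < (2 * n).+1) lam l * (1 + delta l)) - 2 * S lam w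
  else a * (\sum_(1 <= l < (2 * n).+1) (1 + delta l)) -
    2 * \sum_(1 <= l < (2 * n).+1) qfun n lam l w.
exists c; split.
  have adm1 : admissible (fun w => 2 * a * S (fun l => lam l * (1 + delta l)) w).
    exact: (aM _ _ (aq _)).
  have adm2 : admissible (fun w => 2 * a * (2 * S (fun l => 1 + delta l) w)).
    exact: (aM _ _ (aM _ _ (aq _))).
  have adm3 : admissible (fun w => 2 * a * S (fun l => (lam l)^-1 * (1 + delta l)) w).
    exact: (aM _ _ (aq _)).
  have adm4 := admissibleB (admissible_cst (a * (\sum_(1 <= l < (2 * n).+1) lam l * (1 + delta l))))
    (aM 2 _ (aq lam)).
  have adm5 := admissibleB (admissible_cst (a * (\sum_(1 <= l < (2 * n).+1) (1 + delta l))))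
    (aM 2 _ aq').
  move=> s; rewrite /c; case: eqP => _; first exact: adm1.
  case: eqP => _; first exact: adm2.
  case: eqP => _; first exact: adm3.
  by case: eqP => _; [exact: adm4|exact: adm5].
move=> psi w; rewrite !big_cons big_nil /c/= /generator /S addr0.
move: (\sum_(_ <= _ < _) _) (\sum_(_ <= _ < _) _) (\sum_(_ <= _ < _) _).
move: (\sum_(_ <= _ < _) _) (\sum_(_ <= _ < _) _) (\sum_(_ <= _ < _) _).
move: (\sum_(_ <= _ < _) _) ('D_eu ('D_eu psi) w) ('D_eu ('D_ev psi) w).
move: ('D_ev ('D_ev psi) w) ('D_eu psi w) ('D_ev psi w) => *.
ring.
Qed.

End generator_coefficients.

(** * Test functions: supports, moduli of continuity, separability *)

Section test_functions.
Context (R : realType) (n : nat) (lam : nat -> R) (hlam : spectrum n lam).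
Implicit Types psi : R * R -> R.
Local Notation test_function := (test_function n lam).

(** The condition bears on all derivatives, so outside the bounded region where the coefficients are
    controlled the generator has nothing to estimate. *)
Definition supported (m : nat) psi :=
  forall s w, partial s psi w != 0 -> cone n lam w /\ w.1 <= m%:R.

Lemma partial_support psi s w :
  ~ closure [set w | psi w != 0] w -> partial s psi w = 0.
Proof.
set K := closure _; have oK : open (~` K) by exact/closed_openC/closed_closure.
elim: s w => [|b s IH] w Kw /=.
  by apply/eqP; apply: contrapT => /negP h; apply: Kw; exact: subset_closure.
rewrite (@near_eq_derive _ _ _ _ (cst 0)) ?derive_cst//.
have : nbhs w (~` K) by exact: open_nbhs_nbhs.
by apply: filterS => x; exact: IH.
Qed.

Lemma test_function_supported psi : test_function psi -> exists m, supported m psi.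
Proof.
move=> [_ cK Kc]; have [M [_ hM]] := compact_bounded cK.
have [m Mm] := nat_bound (M + 1).
exists m => s w sw0.
have Kw : closure [set w | psi w != 0] w.
  by apply: contrapT => /(@partial_support psi s) h; rewrite h eqxx in sw0.
split; first exact: interior_subset (Kc _ Kw).
apply: le_trans Mm; have := hM (M + 1) _ _ Kw; rewrite ltrDl ltr01 => /(_ isT).
by apply: le_trans; rewrite (le_trans (ler_norm _))//= prod_normE le_max lexx.
Qed.

Lemma test_function_unif psi s : test_function psi -> forall e : R, 0 < e ->
  exists2 d : R, 0 < d & forall x y, ball x d y -> `|partial s psi x - partial s psi y| <= e.
Proof.
move=> [sm cK _] e e0; have [d d0 hd] := compact_unif_continuous cK (sm s).1 e0.
exists d => // x y xy.
have [Kx|Kx] := pselect (closure [set w | psi w != 0] x); first exact/ltW/hd.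
have [Ky|Ky] := pselect (closure [set w | psi w != 0] y).
  by rewrite distrC; apply/ltW/hd => //; exact: ball_sym.
by rewrite !partial_support// subrr normr0 ltW.
Qed.

Lemma test_function_bounded psi s : test_function psi -> exists B, forall w, `|partial s psi w| <= B.
Proof.
move=> [sm cK _].
have := continuous_compact (continuous_subspaceT (sm s).1) cK.
move=> /compact_bounded[M [_ hM]].
exists (Num.max 0 (M + 1)) => w; rewrite le_max.
have [Kw|Kw] := pselect (closure [set w | psi w != 0] w); last first.
  by rewrite partial_support// normr0 lexx.
apply/orP; right; apply: hM; first by rewrite ltrDl.
by exists w.
Qed.

(** The empty word, followed by the derivatives that occur in the generator; of the two mixed ones
    only ['D_eu ('D_ev psi)] occurs there. *)
Definition order2 : seq (seq bool) :=
  [:: [::]; [:: true; true]; [:: true; false]; [:: false; false]; [:: true]; [:: false]].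

Lemma test_function_unif2 psi : test_function psi -> forall M : nat, exists N : nat,
  forall s x y, s \in order2 -> ball x N.+1%:R^-1 y ->
    `|partial s psi x - partial s psi y| <= M.+1%:R^-1.
Proof.
move=> tpsi M; have M0 : 0 < M.+1%:R^-1 :> R by rewrite invr_gt0.
suff H (ss : seq (seq bool)) : exists N : nat, forall s x y, s \in ss -> ball x N.+1%:R^-1 y ->
    `|partial s psi x - partial s psi y| <= M.+1%:R^-1 by exact: H.
elim: ss => [|s ss [N hN]]; first by exists 0%N.
have [d d0 hd] := test_function_unif s tpsi M0.
have [N' hN'] := invn_small d0.
exists (maxn N N') => s' x y; rewrite inE => /predU1P[->|s'ss] xy.
  by apply: hd; apply: le_ball xy; apply: hN'; exact: leq_maxr.
apply: hN => //; apply: le_ball xy.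
by rewrite lef_pV2 ?posrE// ler_nat ltnS leq_maxl.
Qed.

Definition grid_index (m N : nat) : seq (seq bool * nat * nat) :=
  [seq (x, j) | x <- [seq (s, i) | s <- order2, i <- iota 0 (m * N.+1).+1],
                j <- iota 0 (m * N.+1).+1].

Definition grid_point (N i j : nat) : R * R := (i%:R / N.+1%:R, j%:R / N.+1%:R).

(** The derivatives are sampled on a grid of mesh [1/(N+1)] covering [[0, m]^2] and rounded down to
    multiples of [1/(M+1)]. A code is a finite list of integers, so there are countably many. *)
Definition grid_code (m N M : nat) psi : seq int :=
  [seq Num.floor (M.+1%:R * partial x.1.1 psi (grid_point N x.1.2 x.2)) | x <- grid_index m N].

Lemma grid_approx (m N : nat) (w : R * R) : cone n lam w -> w.1 <= m%:R ->
  exists i j, [/\ (i <= m * N.+1)%N, (j <= m * N.+1)%N & ball w N.+1%:R^-1 (grid_point N i j)].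
Proof.
move=> [w2 w21 _] wm.
have H (x : R) : 0 <= x -> x <= m%:R -> exists2 i : nat, (i <= m * N.+1)%N &
    `|x - i%:R / N.+1%:R| < N.+1%:R^-1.
  move=> x0 xm; have xN : 0 <= x * N.+1%:R by rewrite mulr_ge0.
  have /andP[t1 t2] := truncn_itv xN; exists (Num.truncn (x * N.+1%:R)).
    by rewrite -(ler_nat R) natrM (le_trans t1)// ler_wpM2r.
  rewrite ger0_norm; last by rewrite subr_ge0 ler_pdivrMr.
  by rewrite ltrBlDr -[X in X + _]mul1r -mulrDl ltr_pdivlMr// nat1r.
have [i im hi] := H w.1 (le_trans w2 w21) wm.
have [j jm hj] := H w.2 w2 (le_trans w21 wm).
by exists i, j; split.
Qed.

(** The constant 3 counts the oscillation of each function between [w] and a grid point, and the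
    rounding error shared by equal codes. *)
Lemma grid_code_close (m N M : nat) psi psi' : supported m psi -> supported m psi' ->
  (forall s x y, s \in order2 -> ball x N.+1%:R^-1 y ->
    `|partial s psi x - partial s psi y| <= M.+1%:R^-1) ->
  (forall s x y, s \in order2 -> ball x N.+1%:R^-1 y ->
    `|partial s psi' x - partial s psi' y| <= M.+1%:R^-1) ->
  grid_code m N M psi = grid_code m N M psi' ->
  forall s w, s \in order2 -> `|partial s psi w - partial s psi' w| <= 3 / M.+1%:R.
Proof.
move=> sp sp' up up' /eq_in_map code s w ss.
have M0 : 0 <= 3 / M.+1%:R :> R by rewrite divr_ge0.
have [cw|ncw] := pselect (cone n lam w /\ w.1 <= m%:R); last first.
  have z (f : R * R -> R) : supported m f -> partial s f w = 0.
    by move=> sf; apply/eqP; apply: contrapT => /negP/sf.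
  by rewrite !z// subrr normr0.
have [i [j [im jm wg]]] := grid_approx N cw.1 cw.2.
have idx : (s, i, j) \in grid_index m N.
  apply/allpairsP; exists ((s, i), j); split; [|by rewrite mem_iota ltnS|by []].
  by apply/allpairsP; exists (s, i); split; [|rewrite mem_iota ltnS|].
have e : Num.floor (M.+1%:R * partial s psi (grid_point N i j)) =
    Num.floor (M.+1%:R * partial s psi' (grid_point N i j)) := code _ idx.
have h1 := up s w _ ss wg; have h2 := up' s w _ ss wg.
have := floor_itv (M.+1%:R * partial s psi (grid_point N i j)).
have := floor_itv (M.+1%:R * partial s psi' (grid_point N i j)).
rewrite e intrD; move: (_%:~R : R) h1 h2 => k.
move: (partial s psi _) (partial s psi' _) (partial s psi w) (partial s psi' w) => x y a b h1 h2.
rewrite -[M.+1%:R^-1]div1r in h1 h2.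
move=> /andP[ky yk] /andP[kx xk].
have Mp : 0 < M.+1%:R :> R by [].
move: h1 h2; rewrite !ler_pdivlMr//.
have nM c : `|c| * M.+1%:R = `|c * M.+1%:R| by rewrite normrM [X in _ = _ * X]gtr0_norm.
rewrite !nM !mulrBl !ler_norml [M.+1%:R * x]mulrC [M.+1%:R * y]mulrC in kx xk ky yk *.
move: (x * _) (y * _) (a * _) (b * _) kx xk ky yk => x' y' a' b' ? ? ? ?; lra.
Qed.

(* One representative for every grid code that is met: the code of the second
   order jet on a fine grid determines the jet up to a small error. *)
Lemma test_functions_separable : exists D : nat * nat * nat * seq int -> R * R -> R,
  forall psi, test_function psi -> exists2 m : nat, supported m psi & forall e : R, 0 < e ->
    exists k, [/\ test_function (D k), supported m (D k) &
      forall s w, s \in order2 -> `|partial s psi w - partial s (D k) w| <= e].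
Proof.
pose good (k : nat * nat * nat * seq int) psi := let: (m, N, M, c) := k in
  [/\ test_function psi, supported m psi, forall s x y, s \in order2 ->
    ball x N.+1%:R^-1 y -> `|partial s psi x - partial s psi y| <= M.+1%:R^-1 &
    grid_code m N M psi = c].
exists (fun k => xget (cst 0) (good k)) => psi tpsi.
have [m sm] := test_function_supported tpsi; exists m => // e e0.
have e30 : 0 < e / 3 by rewrite divr_gt0.
have [M /(_ _ (leqnn M)) hM] := invn_small e30.
have [N hN] := test_function_unif2 tpsi M.
pose k := (m, N, M, grid_code m N M psi).
have : exists psi', good k psi' by exists psi.
move=> /xgetPex-/(_ (cst 0)); rewrite -/(good k).
set psi' := xget _ _ => -[t' s' u' c'].
exists k; split => // s w ss.
apply: (le_trans (grid_code_close sm s' hN u' (esym c') w ss)).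
by move: hM; rewrite ler_pdivlMr// mulrC.
Qed.

Section generator_bounds.
Context (a : R) (delta : nat -> R).
Local Notation gen := (generator n lam a delta).

(** [C] adds up the bounds of the coefficients on the part of the cone where [w.1 <= m]; beyond it
    all derivatives of both functions vanish. It depends on the support bound [m] alone, whatever
    the two functions. *)
Lemma generator_close (m : nat) : exists2 C : R, 0 <= C & forall psi psi' (e : R),
  supported m psi -> supported m psi' -> 0 <= e ->
  (forall s w, s \in order2 -> `|partial s psi w - partial s psi' w| <= e) ->
  forall w, cone n lam w -> `|gen psi w - gen psi' w| <= C * e.
Proof.
have [c [ac cE]] := generator_coefficients hlam a delta.
have /choice[C hC] s : exists C : R, 0 <= C /\ forall w, cone n lam w -> w.1 <= m%:R -> `|c s w| <= C.
  have [C hC] := (ac s).2 m; exists (Num.max 0 C); split; first by rewrite le_max lexx.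
  by move=> w cw wm; rewrite le_max hC ?orbT.
exists (\sum_(s <- behead order2) C s).
  by apply: sumr_ge0 => s _; have [] := hC s.
move=> psi psi' e sp sp' e0 he w cw; rewrite !cE -sumrB mulr_suml.
apply: (le_trans (ler_norm_sum _ _ _)); rewrite big_seq [leRHS]big_seq.
apply: ler_sum => s ss; have ss2 : s \in order2 by rewrite inE [_ \in _]ss orbT.
rewrite -mulrBr normrM.
have [wm|wm] := pselect (w.1 <= m%:R).
  by apply: ler_pM => //; [exact: (hC s).2|exact: he].
have z (f : R * R -> R) : supported m f -> partial s f w = 0.
  by move=> sf; apply/eqP; apply: contrapT => /negP/sf[].
by rewrite !z// subrr normr0 mulr0 mulr_ge0//; exact: (hC s).1.
Qed.

(** Compare [psi] with the zero function, at distance at most the sum of the bounds of its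
    derivatives. *)
Lemma generator_bounded psi : test_function psi -> exists2 C : R, 0 <= C & forall w, cone n lam w -> `|gen psi w| <= C.
Proof.
move=> tpsi; have [m sm] := test_function_supported tpsi.
have [C C0 hC] := generator_close m.
have p0 s : partial s (cst 0 : R * R -> R) = cst 0.
  elim: s => // b s IH /=; rewrite IH; apply/funext => w; exact: derive_cst.
have s0 : supported m (cst 0) by move=> s w; rewrite p0 eqxx.
have g0 w : gen (cst 0) w = 0.
  have [c [_ ->]] := generator_coefficients hlam a delta.
  by rewrite big1// => s _; rewrite p0 mulr0.
have /choice[B hB] s := test_function_bounded s tpsi.
have B0 s : 0 <= B s by exact: le_trans (hB s 0).
exists (C * \sum_(s <- order2) B s).
  by rewrite mulr_ge0// sumr_ge0.
move=> w cw; suff : `|gen psi w - gen (cst 0) w| <= C * \sum_(s <- order2) B s.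
  by rewrite g0 subr0.
apply: hC => //; first by rewrite sumr_ge0.
move=> s x ss; rewrite p0 subr0 (le_trans (hB s x))//.
by rewrite (bigD1_seq s)//= ler_wpDr// sumr_ge0.
Qed.

End generator_bounds.

End test_functions.

(** * Bounds, continuity and stability of the martingale processes *)

Section bounded_integrals.
Context d (T : measurableType d) (R : realType) (mu : {measure set T -> \bar R}).

Lemma bounded_integrable (D : set T) (f : T -> R) (C : R) :
  measurable D -> (mu D < +oo)%E -> measurable_fun D f ->
  (forall x, D x -> `|f x| <= C) -> mu.-integrable D (EFin \o f).
Proof.
move=> mD Doo mf fC; apply: measurable_bounded_integrable => //.
exists C; split; first exact: num_real.
by move=> M CM x Dx; exact: le_trans (fC x Dx) (ltW CM).
Qed.

Lemma Rintegral_bound (D : set T) (f : T -> R) (C l : R) :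
  measurable D -> mu D = l%:E -> measurable_fun D f ->
  (forall x, D x -> `|f x| <= C) -> `|\int[mu]_(x in D) f x| <= C * l.
Proof.
move=> mD Dl mf fC; have Doo : (mu D < +oo)%E by rewrite Dl ltry.
have -> : l = fine (mu D) by rewrite Dl.
have fi := bounded_integrable mD Doo mf fC.
rewrite -Rintegral_cst// (le_trans (le_normr_Rintegral mD fi))//.
apply: le_Rintegral => //; first by have := integrable_norm fi.
exact: (bounded_integrable (C := `|C|) mD Doo (@measurable_cst _ _ _ _ _ _)).
Qed.

End bounded_integrals.

Section drift.
Context (R : realType).
Implicit Types (g : R -> R) (s t : R).

Lemma lebesgue_itv0 t : 0 <= t -> @lebesgue_measure R `[0, t]%classic = t%:E.
Proof.
move=> t0; rewrite lebesgue_measure_itv/= lte_fin; case: ltP => [_|t0'].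
  by rewrite sube0.
by congr EFin; apply/eqP; rewrite eq_le t0.
Qed.

Lemma lebesgue_itv0_fin t : (@lebesgue_measure R `[0%R, t]%classic < +oo)%E.
Proof.
have [t0|t0] := leP 0 t; first by rewrite lebesgue_itv0// ltry.
by rewrite set_itv_ge ?measure0// bnd_simp -ltNge.
Qed.

Lemma drift_bound g (C t : R) : measurable_fun setT g -> 0 <= t ->
  (forall s, `|g s| <= C) -> `|\int[lebesgue_measure]_(s in `[0, t]) g s| <= C * t.
Proof.
move=> mg t0 gC.
by apply: Rintegral_bound => //; [exact: lebesgue_itv0|exact: measurable_funTS].
Qed.

Lemma drift_lipschitz g (C s t : R) : measurable_fun setT g -> 0 <= s -> s <= t ->
  (forall s, `|g s| <= C) ->
  `|\int[lebesgue_measure]_(u in `[0, t]) g u - \int[lebesgue_measure]_(u in `[0, s]) g u|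
    <= C * (t - s).
Proof.
move=> mg s0 st gC.
rewrite Rintegral_itvB ?bnd_simp//; last first.
  by apply: (bounded_integrable (C := C)) => //;
    [exact: lebesgue_itv0_fin|exact: measurable_funTS].
have mst : lebesgue_measure (`]s, t]%classic : set R) = (t - s)%:E.
  rewrite lebesgue_measure_itv/= lte_fin; case: ltP => // ts.
  by congr EFin; apply/eqP; rewrite eq_sym subr_eq0 eq_le st ts.
by apply: Rintegral_bound => //; exact: measurable_funTS.
Qed.

End drift.

Section martingale_process.
Context (R : realType) (n : nat) (lam : nat -> R) (hlam : spectrum n lam).
Context (a : R) (delta : nat -> R).
Local Notation path_space := (path_space hlam).
Local Notation test_function := (test_function n lam).
Local Notation gen := (generator n lam a delta).
Local Notation X := (martingale_process (hlam := hlam) a delta).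

Lemma measurable_generator_path psi (W : path_space) : test_function psi ->
  measurable_fun setT (fun s : R => gen psi (cone_val (W (totime s)))).
Proof.
move=> [sm _ _]; have [c [ac cE]] := generator_coefficients hlam a delta.
rewrite (_ : (fun s => _) = fun s =>
    \sum_(b <- [:: [:: true; true]; [:: true; false]; [:: false; false]; [:: true]; [:: false]])
    c b (cone_val (W (totime s))) * partial b psi (cone_val (W (totime s)))); last first.
  by apply/funext => s; rewrite cE.
have cW : continuous (fun s : R => cone_val (W (totime s))).
  move=> s; apply: (@continuous_comp _ _ _ (fun s => W (totime s)) (@cone_val _ _ _ hlam)).
    apply: (@continuous_comp _ _ _ (@totime R) W); first exact: totime_continuous.
    exact: cts_fun.
  exact: cone_val_continuous.
have mW : measurable_fun setT (fun s : R => cone_val (W (totime s))).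
  rewrite (_ : (fun s => _) = fun s => (path_coord true (totime s) W, path_coord false (totime s) W)).
    by apply: measurable_fun_pair; apply: continuous_measurable_fun; exact: path_coord_continuous.
  by apply/funext => s; rewrite /path_coord -surjective_pairing.
apply: measurable_sum => b; apply: measurable_funM.
  exact: (measurableT_comp (ac b).1 mW).
apply: continuous_measurable_fun => s.
apply: (@continuous_comp _ _ _ (fun s => cone_val (W (totime s))) (partial b psi)); first exact: cW.
exact: (sm b).1.
Qed.

Lemma cone_val_cone (w : open_cone hlam) : cone n lam (cone_val w).
Proof. exact: interior_subset (cone_val_interior w). Qed.

Lemma martingale_process_bounded psi (T : R) : test_function psi ->
  exists C, forall t W, time_val t <= T -> `|X psi t W| <= C.
Proof.
move=> tpsi; have [B hB] := test_function_bounded [::] tpsi.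
have [C C0 hC] := generator_bounded hlam a delta tpsi.
exists (B + C * T) => t W tT; rewrite /martingale_process (le_trans (ler_normB _ _))//.
rewrite lerD ?hB// (le_trans (@drift_bound R _ C _ _ _ _))//.
- exact: measurable_generator_path.
- exact: time_val_ge0.
- by move=> s; apply: hC; exact: cone_val_cone.
- exact: ler_wpM2l.
Qed.

(** Continuity of the path for the first term, Lipschitz continuity in time for the drift. Times
    come from the right because an event of the past of [t] stays in the past of later times. *)
Lemma martingale_process_cvg psi (s : nat -> R) (t : R) W : test_function psi ->
  0 <= t -> (forall k, t <= s k) -> s @ \oo --> t ->
  X psi (totime (s k)) W @[k --> \oo] --> X psi (totime t) W.
Proof.
move=> tpsi t0 ts st; have [C C0 hC] := generator_bounded hlam a delta tpsi.
have s0 k : 0 <= s k by rewrite (le_trans t0).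
apply: cvgB.
  have cpsi : {for t, continuous (fun s => psi (cone_val (W (totime s))))}.
    apply: (@continuous_comp _ _ _ (fun s => cone_val (W (totime s))) psi); last first.
      by have [sm _ _] := tpsi; exact: (sm [::]).1.
    apply: (@continuous_comp _ _ _ (fun s => W (totime s)) (@cone_val _ _ _ hlam)).
      apply: (@continuous_comp _ _ _ (@totime R) W); first exact: totime_continuous.
      exact: cts_fun.
    exact: cone_val_continuous.
  exact: (cvg_comp _ _ st cpsi).
apply/cvgrPdist_le => e e0.
(* [C] may be 0, hence the division by [C + 1]. *)
have eC : 0 < e / (C + 1) by rewrite divr_gt0// ltr_wpDl.
move/cvgrPdist_le : st => /(_ _ eC); apply: filterS => k sk.
rewrite distrC !totimeK// (le_trans (@drift_lipschitz R _ C _ _ _ _ _ _))//.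
- exact: measurable_generator_path.
- by move=> u; apply: hC; exact: cone_val_cone.
- move: sk; rewrite distrC ger0_norm ?subr_ge0// ler_pdivlMr ?ltr_wpDl//.
  apply: le_trans; rewrite mulrC ler_wpM2l ?subr_ge0// lerDl//.
Qed.

Lemma martingale_process_close (m : nat) : exists2 C : R, 0 <= C & forall psi psi' e,
  test_function psi -> test_function psi' -> supported n lam m psi -> supported n lam m psi' ->
  0 <= e -> (forall s w, s \in order2 -> `|partial s psi w - partial s psi' w| <= e) ->
  forall t W, `|X psi t W - X psi' t W| <= (1 + C * time_val t) * e.
Proof.
have [C C0 hC] := generator_close hlam a delta m; exists C => //.
move=> psi psi' e tp tp' sp sp' e0 he t W.
have mp := measurable_generator_path W tp; have mp' := measurable_generator_path W tp'.
have [B B0 hB] := generator_bounded hlam a delta tp.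
have [B' B0' hB'] := generator_bounded hlam a delta tp'.
have sub4 (x y z u : R) : x - y - (z - u) = x - z - (y - u) by ring.
rewrite /martingale_process sub4 -RintegralB//; last 2 first.
- by apply: (bounded_integrable (C := B)) => //; [exact: lebesgue_itv0_fin|exact: measurable_funTS|
    move=> s _; apply: hB; exact: cone_val_cone].
- by apply: (bounded_integrable (C := B')) => //; [exact: lebesgue_itv0_fin|exact: measurable_funTS|
    move=> s _; apply: hB'; exact: cone_val_cone].
rewrite (le_trans (ler_normB _ _))// mulrDl mul1r lerD//; first exact: (he [::]).
rewrite mulrAC; apply: drift_bound; [exact: measurable_funB|exact: time_val_ge0|].
by move=> s; apply: hC => //; exact: cone_val_cone.
Qed.

End martingale_process.

(** * Stationarity and martingale problem of the mixture *)

Lemma measure_lty d (T : measurableType d) (R : realType)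
  (mu : {measure set T -> \bar R}) (A : set T) :
  (mu setT < +oo)%E -> measurable A -> (mu A < +oo)%E.
Proof. by move=> muT mA; apply: le_lt_trans muT; apply: le_measure; rewrite ?inE. Qed.

Lemma probability_lty d (T : measurableType d) (R : realType) (Q : probability T R)
  (A : set T) : measurable A -> (Q A < +oo)%E.
Proof. by move=> mA; rewrite (le_lt_trans (probability_le1 _ mA))// ltry. Qed.

Section mixture_integral.
Context d d' (T : measurableType d) (U : measurableType d') (R : realType).
Context (pi : probability T R) (P : R.-pker T ~> U).
Local Open Scope ereal_scope.

Import HBNNSimple.

Lemma measurable_kernel_integral (f : U -> \bar R) : (forall z, 0 <= f z) ->
  measurable_fun setT f -> measurable_fun setT (fun w => \int[P w]_z f z).
Proof.
move=> f0 mf; apply: measurable_fun_integral_kernel => // A mA.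
exact: measurable_kernel.
Qed.

Let ge0_integral_mixture_nnsfun (f : {nnsfun U >-> R}) :
  \int[mixture pi P]_z (f z)%:E = \int[pi]_w \int[P w]_z (f z)%:E.
Proof.
under [RHS]eq_integral do rewrite integralT_nnsfun sintegralE.
rewrite integralT_nnsfun sintegralE ge0_integral_fsum//=; last 2 first.
- by move=> r; apply: measurable_funeM; exact: measurable_kernel.
- by move=> r w _; exact: nnsfun_mulemu_ge0.
apply: eq_fsbigr => r _; have [r0|r0] := leP 0%R r.
  by rewrite /mixture ge0_integralZl//; exact: measurable_kernel.
rewrite preimage_nnfun0// measure0 mule0 integral0_eq// => w _.
by rewrite measure0 mule0.
Qed.

(** Simple functions first, then monotone limits. The formula is for nonnegative functions; signed
    bounded ones are made nonnegative by adding a constant. *)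
Lemma ge0_integral_mixture (f : U -> \bar R) : (forall z, 0 <= f z) ->
  measurable_fun setT f ->
  \int[mixture pi P]_z f z = \int[pi]_w \int[P w]_z f z.
Proof.
move=> f0 mf; pose f_ := nnsfun_approx measurableT mf.
have lim_f (m : {measure set U -> \bar R}) :
    \int[m]_z f z = limn (fun n => \int[m]_z (f_ n z)%:E).
  rewrite -monotone_convergence//; last 3 first.
    by move=> n; exact/measurable_EFinP.
    by move=> n z _; rewrite lee_fin.
    by move=> z _ a b ab; rewrite lee_fin; exact/lefP/nd_nnsfun_approx.
  by apply/eq_integral => z _; apply/esym/cvg_lim => //=; exact: cvg_nnsfun_approx.
rewrite lim_f; under [RHS]eq_integral do rewrite lim_f.
rewrite monotone_convergence//; last 3 first.
- move=> n; apply: measurable_kernel_integral => //.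
    by move=> z; rewrite lee_fin.
  exact/measurable_EFinP.
- by move=> n w _; apply: integral_ge0 => z _; rewrite lee_fin.
- move=> w _ a b ab; apply: ge0_le_integral => //.
  + by move=> z _; rewrite lee_fin.
  + exact/measurable_EFinP.
  + exact/measurable_EFinP.
  + by move=> z _; rewrite lee_fin; exact/lefP/nd_nnsfun_approx.
by congr (limn _); apply/funext => n; exact: ge0_integral_mixture_nnsfun.
Qed.

End mixture_integral.

Section existence.
Context (R : realType) (n : nat) (lam : nat -> R) (hlam : spectrum n lam).
Context (a : R) (delta : nat -> R).
Local Notation open_cone := (open_cone hlam).
Local Notation path_space := (path_space hlam).
Context (P : R.-pker open_cone ~> path_space).

Lemma canonical_filtration_measurable (t : time R) (A : set path_space) :
  canonical_filtration t A -> measurable A.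
Proof.
apply: smallest_sub; first exact: sigma_algebra_measurable.
by move=> _ [s [_ [B mB ->]]]; exact: (measurable_preimageT (@measurable_path_eval _ _ _ hlam s)).
Qed.

Lemma canonical_filtration_mono (s t : time R) :
  time_val s <= time_val t -> @canonical_filtration R n lam hlam s `<=` canonical_filtration t.
Proof.
move=> st; apply: sub_smallest2r.
  exact: smallest_sigma_algebra.
move=> _ [u [us [B mB ->]]]; exists u; split; first exact: le_trans st.
by exists B.
Qed.

Hypothesis hP : forall w, starts_at w (P w) /\ martingale_problem a delta (P w).

(** Adaptedness of the time integral is part of what the solution [P point] provides. It involves no
    measure, so one starting point gives it for all laws. *)
Lemma martingale_process_adapted psi : test_function n lam psi ->
  forall t B, measurable B -> canonical_filtration t
    (martingale_process (hlam := hlam) a delta psi t @^-1` B).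
Proof. by move=> /((hP point).2)[]. Qed.

Lemma measurable_martingale_process psi t : test_function n lam psi ->
  measurable_fun setT (martingale_process (hlam := hlam) a delta psi t).
Proof.
move=> tpsi _ B mB; rewrite setTI; apply: canonical_filtration_measurable.
exact: martingale_process_adapted.
Qed.

(* Adaptedness does not involve the measure, and integrability is automatic. *)
Lemma martingale_problemP (Q : probability path_space R) :
  martingale_problem a delta Q <-> forall psi, test_function n lam psi ->
    forall s t, time_val s <= time_val t -> forall A, canonical_filtration s A ->
    (\int[Q]_(W in A) (martingale_process a delta psi t W)%:E =
     \int[Q]_(W in A) (martingale_process a delta psi s W)%:E)%E.
Proof.
split => [mpQ psi /mpQ[]//|h psi tpsi]; split; last exact: h.
  exact: martingale_process_adapted.
move=> t; have [C hC] := martingale_process_bounded hlam a delta (time_val t) tpsi.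
apply: (bounded_integrable (C := C)) => //.
- exact: probability_lty.
- exact: measurable_martingale_process.
- by move=> W _; exact: hC.
Qed.

Lemma mixture_martingale_problem (pi : probability open_cone R) :
  martingale_problem a delta (mixture pi P).
Proof.
apply/martingale_problemP => psi tpsi s t st A sA.
have mA := canonical_filtration_measurable sA.
have [C hC] := martingale_process_bounded hlam a delta (time_val t) tpsi.
pose X u W := martingale_process (hlam := hlam) a delta psi u W.
(* Adding the bound [C] makes the process nonnegative up to time [t], within reach of
   [ge0_integral_mixture]; the term [C * m A] added in this way does not depend on [u] and
   cancels. *)
have shift (m : {measure set path_space -> \bar R}) u : (m setT < +oo)%E -> time_val u <= time_val t ->
    (\int[m]_(W in A) (X u W)%:E =
    \int[m]_W ((X u W + C) * \1_A W)%:E - C%:E * m A)%E.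
  move=> moo ut; have mAoo := measure_lty moo mA.
  have mX : measurable_fun setT (X u) by exact: measurable_martingale_process.
  have Xi : m.-integrable A (EFin \o X u).
    apply: (bounded_integrable (C := C)) => //.
    - exact: measurable_funTS.
    - by move=> W _; exact: hC.
  have Ci : m.-integrable A (EFin \o cst C).
    by apply: (bounded_integrable (C := `|C|)) => //.
  rewrite (_ : (\int[m]_W ((X u W + C) * \1_A W)%:E)%E =
      (\int[m]_(W in A) ((X u W)%:E + C%:E))%E); last first.
    rewrite [RHS]integral_mkcond; apply: eq_integral => W _.
    by rewrite patchE indicE; case: (W \in A); rewrite ?mulr1 ?mulr0.
  rewrite integralD//= integral_cst// addeK// fin_numM//.
  by rewrite ge0_fin_numE.
have E0 u W : time_val u <= time_val t -> (0 <= ((X u W + C) * \1_A W)%:E)%E.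
  move=> ut; rewrite lee_fin mulr_ge0//.
  by have : `|X u W| <= C := hC u W ut; rewrite ler_norml; lra.
have mE u : measurable_fun setT (fun W => ((X u W + C) * \1_A W)%:E).
  apply/measurable_EFinP; apply: measurable_funM => //.
  by apply: measurable_funD => //; exact: measurable_martingale_process.
have mixE u : time_val u <= time_val t ->
    (\int[mixture pi P]_W ((X u W + C) * \1_A W)%:E =
    \int[pi]_w (\int[P w]_(W in A) (X u W)%:E + C%:E * P w A))%E.
  move=> ut; rewrite ge0_integral_mixture//; last by move=> W; exact: E0.
  apply: eq_integral => w _.
  have PT : (P w setT < +oo)%E by rewrite prob_kernel ltry.
  by rewrite (shift (P w) u PT ut) subeK// fin_numM// ge0_fin_numE// measure_lty.
have e : (\int[mixture pi P]_W ((X t W + C) * \1_A W)%:E =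
    \int[mixture pi P]_W ((X s W + C) * \1_A W)%:E)%E.
  apply: (eq_trans (mixE t (lexx (time_val t)))).
  apply: eq_trans (esym (mixE s st)).
  apply: eq_integral => w _.
  have [_ _ h] := (hP w).2 psi tpsi.
  exact: (congr1 (fun z => z + C%:E * P w A)%E (h s t st A sA)).
apply: (eq_trans (shift (mixture pi P) t (probability_lty _ measurableT) (lexx (time_val t)))).
apply: (eq_trans (congr1 (fun z => z - C%:E * mixture pi P A)%E e)).
exact: esym (shift (mixture pi P) s (probability_lty _ measurableT) st).
Qed.

Hypothesis hP_markov : strong_markov P.

(** The strong Markov property at the constant stopping time [s], with the sure event as the past
    event. *)
Lemma markov (s : time R) w (B : set path_space) : measurable B ->
  (P w (shift_path s @^-1` B) = \int[P w]_W P (W s) B)%E.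
Proof.
move=> mB.
have st : stopping_time (fun _ : path_space => (time_val s)%:E).
  split=> [W|t]; first by rewrite lee_fin time_val_ge0.
  have [h|h] := leP (time_val s) (time_val t).
    rewrite (_ : mkset _ = setT); last by apply/seteqP; split => // W _ /=; rewrite lee_fin.
    exact: (@measurableT _ (g_sigma_algebraType _)).
  rewrite (_ : mkset _ = set0); last by apply/seteqP; split => // W /=; rewrite lee_fin leNgt h.
  exact: (@measurable0 _ (g_sigma_algebraType _)).
have sT : stopped_sigma (fun _ : path_space => (time_val s)%:E) setT.
  by split => // t; rewrite setTI; exact: st.2.
have := hP_markov st w sT mB => /=.
rewrite (_ : [set: path_space] `&` _ = setT); last first.
  by apply/seteqP; split => // W _ /=; split => //; rewrite ltry.
by rewrite setTI time_valK.
Qed.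

(** By the Markov property at time [s], the shifted law is the mixture of the [P w] under the law of
    [W s], and this law is again [pi]. *)
Lemma mixture_stationary (pi : probability open_cone R) :
  stationary_distribution P pi -> stationary (mixture pi P).
Proof.
move=> hpi s A mA.
have mPA : measurable_fun setT (P ^~ A) by exact: measurable_kernel.
have me := @measurable_path_eval _ _ _ hlam s.
rewrite [LHS](eq_integral (fun w => \int[P w]_W P (W s) A)%E); last first.
  by move=> w _; rewrite -markov.
rewrite -(ge0_integral_mixture pi P (f := fun W => P (W s) A))//; last first.
  exact: (measurableT_comp mPA me).
transitivity (\int[pushforward (mixture pi P) (fun W : path_space => W s)]_w P w A)%E.
  by rewrite ge0_integral_pushforward.
apply: eq_measure_integral => B mB _.
exact: hpi.
Qed.

End existence.

(** * Reduction to countably many identities *)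

Lemma ler_dist_trans2 (R : realType) (x y z z' c c' : R) :
  `|x - z| <= c -> `|y - z'| <= c' -> z = z' -> `|x - y| <= c + c'.
Proof.
by move=> h1 h2 zz; rewrite -(subrKA z) (le_trans (ler_normD _ _))// lerD// distrC zz.
Qed.

(** Dynkin's theorem: the sets with zero integral form a Dynkin system, complements being covered
    because the integral over the whole space is 0. *)
Lemma Rintegral0_sigma_algebra d (T : measurableType d) (R : realType)
  (m : {measure set T -> \bar R}) (Y : T -> R) (C : R) (G : set (set T)) :
  (m setT < +oo)%E -> measurable_fun setT Y -> (forall x, `|Y x| <= C) ->
  setI_closed G -> G `<=` measurable -> G setT ->
  (forall A, G A -> \int[m]_(x in A) Y x = 0) ->
  forall A, <<s G >> A -> \int[m]_(x in A) Y x = 0.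
Proof.
move=> moo mY YC GI Gm GT G0.
have Yi A : measurable A -> m.-integrable A (EFin \o Y).
  move=> mA; apply: (bounded_integrable (C := C)) => //; first exact: measure_lty.
  exact: measurable_funTS.
suff : <<s G >> `<=` [set A | measurable A /\ \int[m]_(x in A) Y x = 0].
  by move=> h A /h[].
rewrite -setI_closed_g_dynkin_g_sigma_algebra//; apply: smallest_sub; last first.
  by move=> A GA; split; [exact: Gm|exact: G0].
split; first by split => //; exact: G0.
  move=> A [mA A0]; split; first exact: measurableC.
  have := Rintegral_setU (mu := m) mA (measurableC mA) (f := Y).
  rewrite setUv A0 G0// add0r => <- //; first exact: Yi.
  by rewrite disj_set2E setICr.
move=> F tF /= hF; have mF k : measurable (F k) by have [] := hF k.
have mUF : measurable (\bigcup_k F k) by exact: bigcupT_measurable.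
split => //; rewrite /Rintegral integral_bigcup//; last exact: Yi.
rewrite eseries0// => k _ _.
have [_ F0] := hF k.
rewrite -[LHS]fineK; first by rewrite -[fine _]/(\int[m]_(x in F k) Y x) F0.
by apply: integrable_fin_num => //; exact: Yi.
Qed.

Section filtration.
Context (R : realType) (n : nat) (lam : nat -> R) (hlam : spectrum n lam).
Local Notation path_space := (path_space hlam).

(** A triple is a coordinate, a rational time and a rational strict upper bound. There are countably
    many lists, concatenation is intersection, and the empty list is the whole space. *)
Definition cylinder (l : seq (bool * rat * rat)) : set path_space :=
  [set W | all (fun x => path_coord x.1.1 (totime (ratr x.1.2)) W < ratr x.2) l].

Definition times_le (s : rat) (l : seq (bool * rat * rat)) : bool :=
  all (fun x => 0 <= x.1.2 <= s) l.

Lemma cylinder_cat l1 l2 : cylinder (l1 ++ l2) = cylinder l1 `&` cylinder l2.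
Proof.
by apply/seteqP; split => W; rewrite /cylinder/= all_cat => /andP.
Qed.

Lemma cylinder_filtration s l : times_le s l ->
  canonical_filtration (totime (ratr s)) (cylinder l).
Proof.
elim: l => [_|x l IH /= /andP[/andP[x0 xs] /IH ls]].
  rewrite (_ : cylinder _ = setT); last by apply/seteqP.
  exact: (@measurableT _ (g_sigma_algebraType _)).
rewrite -cat1s cylinder_cat.
apply: (@measurableI _ (g_sigma_algebraType _)); last exact: ls.
apply: sub_sigma_algebra; exists (totime (ratr x.1.2)); split.
  by rewrite !totimeK ?ler_rat// ler0q// (le_trans x0).
exists [set w | (if x.1.1 then (cone_val w).1 else (cone_val w).2) < ratr x.2].
  apply: measurable_set_ltr => //; case: (x.1.1).
    exact: (measurableT_comp (@measurable_fst _ _ _ _) (@measurable_cone_val _ _ _ hlam)).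
  exact: (measurableT_comp (@measurable_snd _ _ _ _) (@measurable_cone_val _ _ _ hlam)).
by apply/seteqP; split => W; rewrite /cylinder/= andbT.
Qed.

(** By continuity of paths, the value at a real time [u <= s] is a limit of values at the rational
    times [floor_rat], which do not exceed [u]. *)
Lemma filtration_cylinder (s : rat) : 0 <= s ->
  @canonical_filtration _ _ _ hlam (totime (ratr s)) `<=`
  <<s [set cylinder l | l in [set l | times_le s l]] >>.
Proof.
move=> s0; set G := (X in <<s X >>); apply: smallest_sub.
  exact: smallest_sigma_algebra.
(* The path space with the sigma-algebra generated by the cylinders in place of its own; inclusion
   is then measurability of evaluations on [GT]. *)
pose GT := g_sigma_algebraType G.
have mr b (q : rat) : 0 <= q -> q <= s ->
    measurable_fun setT (path_coord b (totime (ratr q)) : GT -> R).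
  move=> q0 qs; apply: (measurability _ (RGenInftyO.measurableE R)) => //.
  move=> _ [_ [c ->] <-]; rewrite setTI.
  rewrite [X in measurable X](_ : _ =
      \bigcup_(p in [set p : rat | ratr p < c]) cylinder [:: (b, q, p)]).
    rewrite bigcup_mkcond; apply: countable_bigcupT_measurable => // p.
    case: ifP => // _; apply: sub_sigma_algebra; exists [:: (b, q, p)] => //=.
    by rewrite /times_le/= q0 qs.
  apply/seteqP; split => W /=; rewrite ?in_itv/=.
    move=> /rat_in_itvoo[p]; rewrite in_itv/= => /andP[Wp pc].
    by exists p => //; rewrite /cylinder/= Wp.
  by move=> [p /= pc]; rewrite /cylinder/= andbT => /lt_trans; apply.
have mu' b (u : time R) : time_val u <= ratr s ->
    measurable_fun setT (path_coord b u : GT -> R).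
  move=> us; have u0 := time_val_ge0 u.
  apply: (@measurable_fun_cvg _ _ _ setT
      (fun j => path_coord b (totime (ratr (floor_rat (time_val u) j))) : GT -> R)).
    move=> j; apply: mr; first exact: floor_rat_ge0.
    rewrite -(ler_rat R); have /andP[/le_trans h _] := floor_rat_itv j u0.
    exact: h.
  move=> W _.
  have := @path_coord_continuous _ _ _ hlam b W (time_val u).
  by rewrite /continuous_at time_valK => /(cvg_comp _ _ (floor_rat_cvg u0)).
move=> _ [u [us [B mB ->]]].
rewrite totimeK ?ler0q// in us.
have : measurable_fun setT (fun W : GT => (W : path_space) u).
  by apply: measurable_to_cone; [exact: (mu' true)|exact: (mu' false)].
by move=> /measurable_preimageT; apply.
Qed.

Lemma cylinders_setI (s : rat) :
  setI_closed [set cylinder l | l in [set l | times_le s l]].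
Proof.
move=> _ _ [l1 h1 <-] [l2 h2 <-]; exists (l1 ++ l2); last exact: cylinder_cat.
by move: h1 h2; rewrite /times_le/= all_cat => -> ->.
Qed.

End filtration.

Section countable_martingale_problem.
Context (R : realType) (n : nat) (lam : nat -> R) (hlam : spectrum n lam).
Context (a : R) (delta : nat -> R).
Local Notation open_cone := (open_cone hlam).
Local Notation path_space := (path_space hlam).
Local Notation X := (martingale_process (hlam := hlam) a delta).
Context (mX : forall psi t, test_function n lam psi -> measurable_fun setT (X psi t)).
Context (m : {measure set path_space -> \bar R}) (m1 : m setT = 1%E).

Let moo : (m setT < +oo)%E. Proof. by rewrite m1 ltry. Qed.

Let X_integrable psi t A : test_function n lam psi -> measurable A ->
  m.-integrable A (EFin \o X psi t).
Proof.
move=> tpsi mA; have [C hC] := martingale_process_bounded hlam a delta (time_val t) tpsi.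
apply: (bounded_integrable (C := C)) => //; first exact: measure_lty.
  exact: measurable_funTS (mX t tpsi).
by move=> W _; exact: hC.
Qed.

Let rational_times psi (s t : rat) A : test_function n lam psi -> 0 <= s -> s <= t ->
  (forall l, times_le s l -> \int[m]_(W in cylinder l)
     (X psi (totime (ratr t)) W - X psi (totime (ratr s)) W) = 0) ->
  canonical_filtration (totime (ratr s)) A ->
  \int[m]_(W in A) X psi (totime (ratr t)) W = \int[m]_(W in A) X psi (totime (ratr s)) W.
Proof.
move=> tpsi s0 st hl sA; have mA := canonical_filtration_measurable sA.
apply/eqP; rewrite -subr_eq0 -RintegralB//; try exact: X_integrable.
have [C hC] := martingale_process_bounded hlam a delta (ratr t) tpsi.
apply/eqP; apply: (Rintegral0_sigma_algebra (C := C + C) (G := [set cylinder l | l in [set l | times_le s l]])) => //.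
- by apply: measurable_funB; exact: mX.
- move=> W; rewrite (le_trans (ler_normB _ _))// lerD// hC// totimeK ?ler_rat// ler0q//.
  exact: le_trans st.
- exact: cylinders_setI.
- by move=> _ [l hl' <-]; exact: (canonical_filtration_measurable (cylinder_filtration hl')).
- by exists [::] => //; apply/seteqP.
- by move=> _ [l hl' <-]; exact: hl.
- exact: filtration_cylinder.
Qed.

Let integral_cvg psi (s : nat -> R) (t : R) A : test_function n lam psi -> measurable A ->
  0 <= t -> (forall k, t <= s k) -> (forall k, s k <= t + 1) -> s @ \oo --> t ->
  \int[m]_(W in A) X psi (totime (s k)) W @[k --> \oo] --> \int[m]_(W in A) X psi (totime t) W.
Proof.
move=> tpsi mA t0 ts st1 st.
have [C hC] := martingale_process_bounded hlam a delta (t + 1) tpsi.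
have := @dominated_convergence _ _ _ m A mA (fun k => EFin \o X psi (totime (s k)))
  (EFin \o X psi (totime t)) (fun=> C%:E).
case.
- by move=> k; apply/measurable_EFinP/measurable_funTS; exact: mX.
- by apply/measurable_EFinP/measurable_funTS; exact: mX.
- apply: aeW => W _; apply: cvg_EFin; first exact: nearW.
  exact: martingale_process_cvg.
- by apply: (bounded_integrable (C := `|C|)) => //; exact: measure_lty.
- apply: aeW => W k _; rewrite lee_fin hC// totimeK//.
  exact: le_trans (ts k).
move=> _ _ h; apply: fine_cvg; rewrite /Rintegral fineK//.
by apply: integrable_fin_num => //; exact: X_integrable.
Qed.

Let real_times psi (s t : time R) A : test_function n lam psi ->
  (forall (p q : rat) l, 0 <= p -> p <= q -> times_le p l -> \int[m]_(W in cylinder l)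
     (X psi (totime (ratr q)) W - X psi (totime (ratr p)) W) = 0) ->
  time_val s < time_val t -> canonical_filtration s A ->
  \int[m]_(W in A) X psi t W = \int[m]_(W in A) X psi s W.
Proof.
move=> tpsi hl st sA; have mA := canonical_filtration_measurable sA.
have s0 := time_val_ge0 s; have t0 := time_val_ge0 t.
have inv0 k : 0 < k.+1%:R^-1 :> R by rewrite invr_gt0.
have inv1 k : k.+1%:R^-1 <= 1 :> R by rewrite invf_le1// ler1n.
(* The minimum with [t] ensures [p k < t < q k], while [s < p k] keeps [A] in the filtration at time
   [p k]. *)
have /choice[p hp] k : exists p : rat, time_val s < ratr p /\ ratr p < Num.min (time_val t) (time_val s + k.+1%:R^-1).
  have [|p] := @rat_in_itvoo R (time_val s) (Num.min (time_val t) (time_val s + k.+1%:R^-1)).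
    by rewrite lt_min st ltrDl inv0.
  by rewrite in_itv/= => /andP[? ?]; exists p.
have /choice[q hq] k : exists q : rat, time_val t < ratr q /\ ratr q < time_val t + k.+1%:R^-1.
  have [|q] := @rat_in_itvoo R (time_val t) (time_val t + k.+1%:R^-1); first by rewrite ltrDl.
  by rewrite in_itv/= => /andP[? ?]; exists q.
have sq (u : R) (r : nat -> rat) : (forall k, u < ratr (r k) /\ ratr (r k) < u + k.+1%:R^-1) ->
    (ratr (r k) : R) @[k --> \oo] --> u.
  move=> hr; apply/cvgrPdist_le => e /invn_small[N hN]; exists N => // k /= Nk.
  have [h1 h2] := hr k; rewrite distrC ger0_norm; last by rewrite subr_ge0 ltW.
  by rewrite lerBlDl (le_trans (ltW h2))// lerD2l hN.
have hp' k : time_val s < ratr (p k) /\ ratr (p k) < time_val s + k.+1%:R^-1.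
  by have [h] := hp k; rewrite lt_min => /andP[].
have c1 := @integral_cvg psi (fun k => ratr (p k)) (time_val s) A tpsi mA s0
  (fun k => ltW (hp' k).1) (fun k => le_trans (ltW (hp' k).2) (lerD (lexx _) (inv1 k))) (sq _ _ hp').
have c2 := @integral_cvg psi (fun k => ratr (q k)) (time_val t) A tpsi mA t0
  (fun k => ltW (hq k).1) (fun k => le_trans (ltW (hq k).2) (lerD (lexx _) (inv1 k))) (sq _ _ hq).
rewrite !time_valK in c1 c2.
apply: (cvg_unique (@Rhausdorff R) c2).
apply: cvg_trans c1; apply: near_eq_cvg; apply: nearW => k /=.
have p0 : 0 <= p k by rewrite -(ler0q R) (le_trans s0)// ltW// (hp k).1.
have pq : p k <= q k.
  have [_] := hp k; rewrite lt_min => /andP[pt _].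
  by rewrite -(ler_rat R) ltW// (lt_trans pt)// (hq k).1.
apply/esym; apply: rational_times => //; first by move=> l; exact: hl.
apply: canonical_filtration_mono sA.
by rewrite totimeK ?ler0q// ltW// (hp k).1.
Qed.

Lemma martingale_problem_countable (I : Type) (D : I -> R * R -> R) :
  (forall psi, test_function n lam psi -> exists2 m : nat, supported n lam m psi & forall e : R, 0 < e ->
    exists k, [/\ test_function n lam (D k), supported n lam m (D k) &
      forall s w, s \in order2 -> `|partial s psi w - partial s (D k) w| <= e]) ->
  (forall k (p q : rat) l, test_function n lam (D k) -> 0 <= p -> p <= q -> times_le p l ->
    \int[m]_(W in cylinder l)
     (X (D k) (totime (ratr q)) W - X (D k) (totime (ratr p)) W) = 0) ->
  forall psi, test_function n lam psi -> forall s t, time_val s <= time_val t ->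
  forall A, canonical_filtration s A ->
    (\int[m]_(W in A) (X psi t W)%:E = \int[m]_(W in A) (X psi s W)%:E)%E.
Proof.
move=> dense hD psi tpsi s t; rewrite le_eqVlt => /predU1P[/val_inj <-//|st] A sA.
have mA := canonical_filtration_measurable sA.
have [M sM dM] := dense psi tpsi.
have [C C0 hC] := martingale_process_close hlam a delta M.
suff e : \int[m]_(W in A) X psi t W = \int[m]_(W in A) X psi s W.
  have fK u : (\int[m]_(W in A) (X psi u W)%:E = (\int[m]_(W in A) X psi u W)%:E)%E.
    by apply/esym/fineK/integrable_fin_num; [exact: mA|exact: X_integrable].
  by rewrite !fK e.
(* Replacing [psi] by [D k] costs [1 + C * u] times the approximation error at each of the times
   [u = t] and [u = s]; [K] is the total. [C] is fixed before [k], since it depends on the support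
   bound [M] only. *)
have [K KE K0] : exists2 K, K = 1 + C * time_val t + (1 + C * time_val s) & 0 < K.
  exists (1 + C * time_val t + (1 + C * time_val s)) => //.
  by rewrite !ltr_wpDr// ?mulr_ge0 ?time_val_ge0// addr_ge0// mulr_ge0// time_val_ge0.
apply/eqP; rewrite -subr_eq0 -normr_le0; apply/ler_addgt0Pl => e e0; rewrite addr0.
have [k [tk sk dk]] := dM (e / K) (divr_gt0 e0 K0).
have eK : 0 <= e / K by rewrite ltW// divr_gt0.
have close u : `|\int[m]_(W in A) X psi u W - \int[m]_(W in A) X (D k) u W| <= (1 + C * time_val u) * (e / K).
  rewrite -RintegralB//; try exact: X_integrable.
  have [l ml] : exists l, m A = l%:E.
    by exists (fine (m A)); rewrite fineK// ge0_fin_numE// measure_lty.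
  have l1 : l <= 1.
    by rewrite -lee_fin -ml -m1; apply: le_measure; rewrite ?inE.
  apply: (le_trans (@Rintegral_bound _ _ R m A _ ((1 + C * time_val u) * (e / K)) l mA ml _ _)).
  - by apply: measurable_funTS; apply: measurable_funB; exact: mX.
  - by move=> W _; exact: hC.
  - by rewrite ler_piMr// mulr_ge0// addr_ge0// mulr_ge0// time_val_ge0.
have eqk := real_times tk (fun p q l => hD k p q l tk) st sA.
have eE : e = (1 + C * time_val t) * (e / K) + (1 + C * time_val s) * (e / K).
  have Kn0 : K != 0 by rewrite gt_eqF.
  by rewrite -mulrDl -KE mulrC divfK.
rewrite [leRHS]eE.
exact: (ler_dist_trans2 (close t) (close s) eqk).
Qed.

End countable_martingale_problem.

(** * Disintegration along the starting point *)

Section randomization.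
Context (R : realType) (n : nat) (lam : nat -> R) (hlam : spectrum n lam).
Local Notation open_cone := (open_cone hlam).
Local Notation path_space := (path_space hlam).
Local Notation U01 := (uniform_prob (@ltr01 R)).

Definition initial_point (W : path_space) : open_cone := W (totime 0).

Lemma measurable_initial_point : measurable_fun setT initial_point.
Proof. exact: measurable_path_eval. Qed.

HB.instance Definition _ := isMeasurableFun.Build _ _ _ _ initial_point
  measurable_initial_point.

Definition initial_law (Q : probability path_space R) : probability open_cone R :=
  distribution Q initial_point.

(* The laws of the [G (w, -)] disintegrate [Q] with respect to the starting point. *)
Lemma path_randomization (Q : probability path_space R) :
  exists G : open_cone * measurableTypeR R -> path_space,
  [/\ measurable_fun setT G,
      forall A, measurable A -> (initial_law Q \x U01)%E (G @^-1` A) = Q A &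
      exists N, [/\ measurable N, (initial_law Q \x U01)%E N = 0%E &
        forall x, ~ N x -> initial_point (G x) = x.1]].
Proof.
have [phi [g [mphi mg phi01 gK]]] := path_space_retract hlam.
pose phi' : {mfun path_space >-> R} := HB.pack phi (isMeasurableFun.Build _ _ _ _ phi mphi).
have [Z [mZ ZE]] := @uniform_transfer R _ _ _ _ Q initial_point phi' phi01.
have law B A : measurable B -> measurable A ->
    (initial_law Q \x U01)%E (fst @^-1` B `&` (g \o Z) @^-1` A) =
    Q (initial_point @^-1` B `&` A).
  move=> mB mA; have mgA : measurable (g @^-1` A) by exact: measurable_preimageT.
  apply: (eq_trans (ZE B _ mB mgA)); congr (Q (_ `&` _)).
  by apply/seteqP; split => W /=; rewrite gK.
have mG : measurable_fun setT (g \o Z) by exact: measurableT_comp.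
exists (g \o Z); split => //.
  move=> A mA; have := law setT A measurableT mA.
  by rewrite !preimage_setT !setTI.
pose crd (b : bool) (w : open_cone) : R := if b then (cone_val w).1 else (cone_val w).2.
have mcrd b : measurable_fun setT (crd b).
  rewrite /crd; case: b.
    exact: (measurableT_comp (@measurable_fst _ _ _ _) (@measurable_cone_val _ _ _ hlam)).
  exact: (measurableT_comp (@measurable_snd _ _ _ _) (@measurable_cone_val _ _ _ hlam)).
pose lo b (q : rat) := [set w | crd b w < ratr q].
pose hi b (q : rat) := [set w | ratr q <= crd b w].
have mlo b q : measurable (lo b q) by exact: measurable_set_ltr.
have mhi b q : measurable (hi b q) by exact: measurable_set_ler.
(* If [G x] does not start at [x.1], a rational separates a coordinate of the two points; the last
   boolean tells on which side. Under the joint law each such event is [Q] of an empty set. *)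
pose bad (i : bool * rat * bool) :=
  let A := if i.2 then lo i.1.1 i.1.2 else hi i.1.1 i.1.2 in
  let B := if i.2 then hi i.1.1 i.1.2 else lo i.1.1 i.1.2 in
  fst @^-1` A `&` (g \o Z) @^-1` (initial_point @^-1` B) : set (open_cone * R).
have mbad i : measurable (bad i).
  apply: measurableI; first by apply: measurable_preimageT => //; case: ifP.
  apply: measurable_preimageT => //; apply: measurable_preimageT.
    exact: measurable_initial_point.
  by case: ifP.
have bad0 i : (initial_law Q \x U01)%E (bad i) = 0%E.
  rewrite /bad law; [|by case: ifP|]; last first.
    apply: measurable_preimageT; first exact: measurable_initial_point.
    by case: ifP.
  rewrite [X in Q X](_ : _ = set0) ?measure0//; apply/seteqP; split => // W /=.
  by case: (i.2) => -[] /=; rewrite /lo /hi/=; [rewrite ltNge => /negP|move=> /[swap]; rewrite ltNge => /negP].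
exists (\bigcup_i bad i); split.
- by apply: countable_bigcupT_measurable.
- pose bad' (k : nat) := if unpickle k is Some i then bad i else set0.
  rewrite (_ : \bigcup_i bad i = \bigcup_k bad' k); last first.
    apply/seteqP; split => x [i _ ix]; first by exists (pickle i) => //; rewrite /bad' pickleK.
    by move: ix; rewrite /bad'; case: (unpickle i) => // j jx; exists j.
  have [] := @negligible_bigcup _ _ _ (initial_law Q \x U01)%E bad'.
    move=> k; rewrite /bad'; case: (unpickle k) => [i|]; last exact: negligible_set0.
    by exists (bad i); split; [exact: mbad|exact: bad0|].
  move=> N [mN N0 sub]; apply/eqP; rewrite -measure_le0 -N0.
  apply: le_measure; rewrite ?inE//; apply: bigcupT_measurable => k.
  by rewrite /bad'; case: (unpickle k).
move=> x nx; apply: cone_val_inj.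
have cE b : crd b (initial_point ((g \o Z) x)) = crd b x.1.
  apply: contrapT => /eqP; rewrite neq_lt => /orP[] /rat_in_itvoo[q];
    rewrite in_itv/= => /andP[h1 h2]; apply: nx.
    by exists (b, q, false) => //; split; rewrite /lo/hi/= ?ltW.
  by exists (b, q, true) => //; split; rewrite /lo/hi/= ?ltW.
rewrite [LHS]surjective_pairing [RHS]surjective_pairing.
by congr pair; [exact: (cE true)|exact: (cE false)].
Qed.

End randomization.

Arguments initial_point {R n lam hlam}.

Section product_slices.
Context d1 d2 (T1 : measurableType d1) (T2 : measurableType d2) (R : realType).
Context (m1 : probability T1 R) (m2 : probability T2 R).

Lemma ae_xsection_null (N : set (T1 * T2)) : measurable N -> (m1 \x m2)%E N = 0%E ->
  {ae m1, forall x, m2 (xsection N x) = 0%E}.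
Proof.
move=> mN N0.
have mF : measurable_fun setT (fun x => m2 (xsection N x)).
  exact: measurable_fun_xsection.
have : (\int[m1]_x `|m2 (xsection N x)| = 0)%E.
  by rewrite -[RHS]N0; apply: eq_integral => x _; rewrite gee0_abs.
move=> /(ae_eq_integral_abs m1 measurableT mF).
by apply: filterS => x /(_ I).
Qed.

Lemma product_lty : ((m1 \x m2)%E setT < +oo)%E.
Proof.
have -> : (m1 \x m2)%E setT = (m1 \x m2)%E (setT `*` setT) by rewrite setXTT.
rewrite product_measure1E//.
by rewrite [X in (X * _)%E]probability_setT [X in (_ * X)%E]probability_setT mule1 ltry.
Qed.

(** By Fubini's theorem the partial integral of [H] in the second variable has zero integral on
    every measurable [B], hence vanishes almost everywhere. *)
Lemma ae_slice_integral0 (H : T1 * T2 -> R) (C : R) :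
  measurable_fun setT H -> (forall x, `|H x| <= C) ->
  (forall B, measurable B -> (\int[m1 \x m2]_x (H x * \1_B x.1)%:E = 0)%E) ->
  {ae m1, forall x, (\int[m2]_y (H (x, y))%:E = 0)%E}.
Proof.
move=> mH HC H0; pose F x := (\int[m2]_y (H (x, y))%:E)%E.
have HBi B : measurable B -> (m1 \x m2)%E.-integrable setT (EFin \o (fun x => H x * \1_B x.1)).
  move=> mB; apply: (bounded_integrable (C := C)) => //; first exact: product_lty.
    apply: measurable_funM => //.
    by apply: (measurableT_comp (f := (\1_B : T1 -> R))) => //; exact: measurable_fst.
  move=> x _; rewrite normrM indicE; case: (_ \in _); rewrite ?normr1 ?mulr1// normr0 mulr0.
  exact: le_trans (HC x).
have HBF B : measurable B -> (\int[m1]_(x in B) F x = 0)%E.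
  move=> mB; rewrite -(H0 B mB) -(integral12_prod_meas1 (HBi _ mB)) integral_mkcond.
  apply: eq_integral => x _; rewrite patchE /fubini_F; case: ifPn => xB.
    by apply: eq_integral => y _; rewrite /= indicE xB mulr1.
  by rewrite integral0_eq// => y _; rewrite /= indicE (negbTE xB) mulr0.
have Fi : m1.-integrable setT F.
  have Hi : (m1 \x m2)%E.-integrable setT (EFin \o H).
    by apply: (bounded_integrable (C := C)) => //; exact: product_lty.
  exact: (integrable_fubini_F Hi).
have := integral_ae_eq (mu := m1) measurableT Fi (@measurable_cst _ _ _ _ setT 0%E).
case=> [E _ mE|N h]; first by rewrite HBF// integral0.
by exists N; case: h => mN N0 sub; split => // x /= hx; apply: sub => /=; tauto.
Qed.

End product_slices.

Section disintegration.
Context (R : realType) (n : nat) (lam : nat -> R) (hlam : spectrum n lam).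
Context (a : R) (delta : nat -> R).
Local Notation open_cone := (open_cone hlam).
Local Notation path_space := (path_space hlam).
Local Notation U01 := (uniform_prob (@ltr01 R)).
Local Notation X := (martingale_process (hlam := hlam) a delta).
Context (P : R.-pker open_cone ~> path_space).
Hypothesis hP : forall w, starts_at w (P w) /\ martingale_problem a delta (P w).
Context (Q : probability path_space R) (mpQ : martingale_problem a delta Q).
Local Notation nu := (initial_law Q).
Context (G : open_cone * measurableTypeR R -> path_space) (mG : measurable_fun setT G).
Hypothesis GQ : forall A, measurable A -> (nu \x U01)%E (G @^-1` A) = Q A.
Hypothesis G0 : exists N, [/\ measurable N, (nu \x U01)%E N = 0%E &
  forall x, ~ N x -> initial_point (G x) = x.1].

Lemma measurable_slice w : measurable_fun setT (fun u => G (w, u)).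
Proof. exact: (measurableT_comp mG (pair1_measurable w)). Qed.

Definition slice (w : open_cone) : {mfun measurableTypeR R >-> path_space} :=
  HB.pack (fun u => G (w, u))
    (isMeasurableFun.Build _ _ (measurableTypeR R) path_space _ (measurable_slice w)).

(** A version of the conditional law of [Q] given that the path starts at [w]. *)
Definition slice_law w : probability path_space R := distribution U01 (slice w).

Lemma slice_law_starts : {ae nu, forall w, starts_at w (slice_law w)}.
Proof.
have [N [mN N0 hN]] := G0.
apply: filterS (ae_xsection_null mN N0) => w Nw.
have mS : measurable [set W : path_space | W (totime 0) = w].
  rewrite (_ : mkset _ = (path_coord true (totime 0) @^-1` [set (cone_val w).1]) `&`
      (path_coord false (totime 0) @^-1` [set (cone_val w).2])).
    by apply: measurableI; apply: measurable_preimageT => //; exact: measurable_path_coord.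
  apply/seteqP; split => W /=; first by move=> <-.
  move=> [h1 h2]; apply: cone_val_inj.
  by rewrite [LHS]surjective_pairing [RHS]surjective_pairing; congr pair.
set S := mkset _ in mS; rewrite /starts_at -/S.
have mS' := measurable_preimageT (measurable_slice w) mS.
have S0 : U01 (~` ((fun u => G (w, u)) @^-1` S)) = 0%E.
  apply/eqP; rewrite -measure_le0 -Nw; apply: le_measure; rewrite ?inE.
  - exact: measurableC.
  - exact: measurable_xsection.
  - move=> u /= hu; rewrite /xsection/= inE; apply: contrapT => /hN; exact: hu.
have := probability_setC U01 (measurableC mS').
rewrite setCK => e; apply: (eq_trans e).
exact: (eq_trans (congr1 (fun z => 1 - z)%E S0) (sube0 1%E)).
Qed.

Lemma slice_law_increment psi (s t : rat) l : test_function n lam psi ->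
  0 <= s -> s <= t -> times_le s l ->
  {ae nu, forall w, \int[slice_law w]_(W in cylinder l)
    (X psi (totime (ratr t)) W - X psi (totime (ratr s)) W) = 0}.
Proof.
move=> tpsi s0 st hl; pose A : set path_space := cylinder l.
pose Y W := X psi (totime (ratr t)) W - X psi (totime (ratr s)) W.
suff : {ae nu, forall w, \int[slice_law w]_(W in A) Y W = 0} by [].
have t0 := le_trans s0 st.
have sA : canonical_filtration (totime (ratr s)) A by exact: cylinder_filtration.
have mA : measurable A := canonical_filtration_measurable sA.
have mX u := measurable_martingale_process hP u tpsi.
have mY : measurable_fun setT Y by exact: measurable_funB.
have [C hC] := martingale_process_bounded hlam a delta (ratr t) tpsi.
have YC W : `|Y W| <= C + C.
  by rewrite (le_trans (ler_normB _ _))// lerD// hC// totimeK ?ler_rat// ler0q.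
have C0 : 0 <= C + C by exact: le_trans (YC point).
pose Z (B : set open_cone) W : R := Y W * \1_(A `&` initial_point @^-1` B) W.
have mB' B : measurable B -> measurable (A `&` initial_point @^-1` B).
  by move=> mB; apply: measurableI => //; apply: measurable_preimageT.
have mZ B : measurable B -> measurable_fun setT (Z B).
  by move=> mB; apply: measurable_funM => //; apply: measurable_indic; exact: mB'.
have ZC B W : `|Z B W| <= C + C.
  rewrite normrM indicE; case: (_ \in _); rewrite ?normr1 ?mulr1//.
  by rewrite normr0 mulr0.
have ZQ B : measurable B -> (\int[Q]_W (Z B W)%:E = 0)%E.
  move=> mB; have sB : canonical_filtration (totime (ratr s)) (A `&` initial_point @^-1` B).
    apply: (@measurableI _ (g_sigma_algebraType _)); first exact: sA.
    apply: sub_sigma_algebra; exists (totime 0); split; last by exists B.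
    by rewrite !totimeK ?ler0q.
  have Xi u : time_val u <= ratr t -> Q.-integrable (A `&` initial_point @^-1` B) (EFin \o X psi u).
    move=> ut; apply: (bounded_integrable (C := C)).
    - exact: mB'.
    - exact: probability_lty (mB' _ mB).
    - exact: measurable_funTS.
    - by move=> W _; exact: hC.
  have -> : (\int[Q]_W (Z B W)%:E = \int[Q]_(W in A `&` initial_point @^-1` B) (Y W)%:E)%E.
    rewrite [RHS]integral_mkcond; apply: eq_integral => W _.
    by rewrite patchE /Z indicE; case: (W \in _); rewrite ?mulr1 ?mulr0.
  rewrite /Y (integralB _ (Xi _ _) (Xi _ _))//; last 3 first.
  - exact: mB'.
  - by rewrite totimeK// ler0q.
  - by rewrite totimeK ?ler_rat ?ler0q.
  have [_ _ mart] := mpQ tpsi.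
  rewrite (mart (totime (ratr s)) (totime (ratr t)) _ _ sB) ?subee//.
    by apply: integrable_fin_num; [exact: mB'|apply: Xi; rewrite totimeK ?ler_rat ?ler0q].
  by rewrite !totimeK ?ler_rat ?ler0q.
have slice0 : {ae nu, forall w, (\int[U01]_u (Y (G (w, u)) * \1_A (G (w, u)))%:E = 0)%E}.
  apply: (@ae_slice_integral0 _ _ open_cone (measurableTypeR R) R nu U01
    (fun x : open_cone * measurableTypeR R => Y (G x) * \1_A (G x)) (C + C)).
  - apply: measurable_funM; first exact: measurableT_comp mY mG.
    by apply: (measurableT_comp (f := (\1_A : path_space -> R))) => //.
  - move=> x; rewrite normrM indicE; case: (_ \in _); rewrite ?normr1 ?mulr1//.
    by rewrite normr0 mulr0.
  - move=> B mB.
    have mZG : measurable_fun setT (fun x => (Z B (G x))%:E).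
      by apply/measurable_EFinP; exact: measurableT_comp (mZ _ mB) mG.
    have -> : (\int[nu \x U01]_x (Y (G x) * \1_A (G x) * \1_B x.1)%:E =
        \int[nu \x U01]_x (Z B (G x))%:E)%E.
      apply: ae_eq_integral => //.
        apply/measurable_EFinP; apply: measurable_funM.
          apply: measurable_funM; first exact: measurableT_comp mY mG.
          by apply: (measurableT_comp (f := (\1_A : path_space -> R))).
        by apply: (measurableT_comp (f := (\1_B : open_cone -> R))) => //; exact: measurable_fst.
      (* Outside [N] the path [G x] starts at [x.1], so that the indicator of [B] at [x.1] is an
         indicator on the path space and the integral can be carried over to [Q]. *)
      have [N [mN N0 hN]] := G0; exists N; split => // x /= hx.
      apply: contrapT => /hN Gx; apply: hx => _; congr EFin.
      rewrite /Z -mulrA; congr (_ * _); rewrite -Gx !indicE in_setI.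
      rewrite (_ : (G x \in initial_point @^-1` B) = (initial_point (G x) \in B)).
        by case: (_ \in _); case: (_ \in _); rewrite ?mulr1 ?mulr0.
      by apply/idP/idP => /set_mem ?; exact: mem_set.
    have mZE : measurable_fun setT (EFin \o Z B) by apply/measurable_EFinP; exact: mZ.
    have iZG : (nu \x U01)%E.-integrable (G @^-1` setT) (EFin \o Z B \o G).
      rewrite preimage_setT.
      apply: (@bounded_integrable _ _ R (nu \x U01)%E setT (Z B \o G) (C + C)) => //.
      - exact: product_lty.
      - exact: measurableT_comp (mZ _ mB) mG.
      - by move=> x _; exact: ZC.
    have := integral_pushforward mG mZE iZG measurableT.
    rewrite preimage_setT => <-.
    rewrite -[RHS](ZQ B mB); apply: eq_measure_integral => D mD _.
    exact: GQ.
apply: filterS slice0 => w h.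
have mS := measurable_slice w.
have mYE : measurable_fun setT (EFin \o Y) by apply/measurable_EFinP.
have iYS : U01.-integrable ((fun u => G (w, u)) @^-1` A) (EFin \o Y \o (fun u => G (w, u))).
  have mSA := measurable_preimageT mS mA.
  apply: (@bounded_integrable _ _ R U01 _ (Y \o (fun u => G (w, u))) (C + C)).
  - exact: mSA.
  - exact: (probability_lty _ mSA).
  - by apply: measurable_funTS; exact: measurableT_comp mY mS.
  - by move=> u _; exact: YC.
have e := integral_pushforward mS mYE iYS mA.
rewrite /Rintegral.
have -> : (\int[slice_law w]_(W in A) (Y W)%:E = 0)%E.
  apply: (eq_trans e); rewrite -[RHS]h integral_mkcond; apply: eq_integral => u _.
  by rewrite patchE /= indicE (_ : (u \in _) = (G (w, u) \in A)) ?inE//;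
    case: (_ \in _); rewrite ?mulr1 ?mulr0.
by [].
Qed.

(** One null set serves for all identities: they are indexed by the code of a test function, two
    rational times and the list of a cylinder, a countable type. *)
Lemma slice_law_martingale_problem :
  {ae nu, forall w, martingale_problem a delta (slice_law w)}.
Proof.
have [D dense] := @test_functions_separable R n lam.
have : {ae nu, forall w, forall i : (nat * nat * nat * seq int) * (rat * rat * seq (bool * rat * rat)),
    test_function n lam (D i.1) -> 0 <= i.2.1.1 -> i.2.1.1 <= i.2.1.2 -> times_le i.2.1.1 i.2.2 ->
    \int[slice_law w]_(W in cylinder i.2.2)
    (X (D i.1) (totime (ratr i.2.1.2)) W - X (D i.1) (totime (ratr i.2.1.1)) W) = 0}.
  apply: ae_forall_countable => i.
  have [[tD s0 st hl]|no] := pselect [/\ test_function n lam (D i.1), 0 <= i.2.1.1,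
      i.2.1.1 <= i.2.1.2 & times_le i.2.1.1 i.2.2].
    by apply: filterS (slice_law_increment tD s0 st hl) => w + _ _ _ _.
  by apply/aeW => w *; exfalso; apply: no.
apply: filterS => w hw; apply/(martingale_problemP hP).
have mX psi u := @measurable_martingale_process _ _ _ _ _ _ _ hP psi u.
apply: (martingale_problem_countable mX (probability_setT _) dense).
by move=> k p q l tk p0 pq hl; exact: (hw (k, (p, q, l)) tk p0 pq hl).
Qed.

Hypothesis hP_unique : forall w (Q : probability path_space R),
  starts_at w Q -> martingale_problem a delta Q ->
  forall A, measurable A -> Q A = P w A.

Lemma disintegration A : measurable A -> Q A = mixture nu P A.
Proof.
move=> mA; rewrite -GQ// /mixture.
have mGA : measurable (G @^-1` A) by exact: measurable_preimageT.
rewrite /product_measure1; apply: ae_eq_integral => //.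
- exact: measurable_fun_xsection.
- exact: measurable_kernel.
apply: filterS2 slice_law_starts slice_law_martingale_problem => w hs hm _.
rewrite -(hP_unique hs hm mA) /=.
congr (U01 _); apply/seteqP; split => u; rewrite /xsection/= inE//.
Qed.

End disintegration.

Theorem proposition4p2 (R : realType) (n : nat) (lam : nat -> R)
  (hlam : spectrum n lam) (a : R) (ha : 0 < a) (delta : nat -> R)
  (hdelta : forall l, (1 <= l <= 2 * n)%N -> -1 < delta l <= 0)
  (hdelta_pair : forall i, (1 <= i <= n)%N ->
    delta (2 * i)%N = delta (2 * i - 1)%N)
  (P : R.-pker (open_cone hlam) ~> (path_space hlam))
  (hP : forall w, starts_at w (P w) /\ martingale_problem a delta (P w))
  (hP_unique : forall w (Q : probability (path_space hlam) R),
    starts_at w Q -> martingale_problem a delta Q ->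
    forall A, measurable A -> Q A = P w A)
  (hP_markov : strong_markov P)
  (pi : probability (open_cone hlam) R)
  (hpi : stationary_distribution P pi)
  (hpi_unique : forall pi' : probability (open_cone hlam) R,
    stationary_distribution P pi' ->
    forall B, measurable B -> pi' B = pi B) :
  let Ptilde : probability (path_space hlam) R := mixture pi P in
  (stationary Ptilde /\ martingale_problem a delta Ptilde) /\
  forall Q : probability (path_space hlam) R,
    stationary Q -> martingale_problem a delta Q ->
    forall A, measurable A -> Q A = Ptilde A.
Proof.
move=> Ptilde; split.
  split; first exact: mixture_stationary.
  exact: mixture_martingale_problem.
move=> Q sQ mpQ A mA.
have [G [mG GQ G0]] := path_randomization Q.
have QE B : measurable B -> Q B = mixture (initial_law Q) P B.
  by move=> mB; exact: (disintegration hP mpQ mG GQ G0 hP_unique).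
(* On the event that [W t] lies in [B], the mixture formula gives the integral in the definition of
   a stationary distribution; stationarity of [Q] replaces [W t] by [W 0]. *)
have nu_stat : stationary_distribution P (initial_law Q).
  move=> t B mB.
  have mWt : measurable [set W : path_space hlam | B (W t)].
    exact: (measurable_preimageT (@measurable_path_eval _ _ _ hlam t)).
  have mW0 : measurable [set W : path_space hlam | B (initial_point W)].
    exact: (measurable_preimageT (@measurable_initial_point _ _ _ hlam)).
  apply: (eq_trans (esym (QE _ mWt))); rewrite -[RHS](sQ t _ mW0).
  have shift0 W : initial_point (shift_path t W) = W t :> open_cone hlam.
    transitivity (W (totime (time_val t + time_val (totime (0 : R))))) => //.
    by rewrite totimeK// addr0 time_valK.
  by congr (Q _); apply/funext => W; exact: (congr1 B (esym (shift0 W))).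
(* Both mixtures integrate the same kernel, so agreement of [initial_law Q] with [pi] on measurable
   sets is enough. *)
rewrite QE//; apply: eq_measure_integral => B mB _.
exact: hpi_unique.
Qed.
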